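(* Let $k_0\in\mathbb{Z}$. Then the set of Laurent polynomials $\{p_+(\cdot,k,k_0)\}_{k\geq k_0}$ forms an orthonormal basis in $L^2(\partial\mathbb{D};d\mu_+(\cdot,k_0))$, and so does $\{r_+(\cdot,k,k_0)\}_{k\geq k_0}$. Likewise, each of the sets $\{p_-(\cdot,k,k_0)\}_{k\leq k_0}$ and $\{r_-(\cdot,k,k_0)\}_{k\leq k_0}$ forms an orthonormal basis in $L^2(\partial\mathbb{D};d\mu_-(\cdot,k_0))$. Here $$d\mu_\pm(\zeta,k_0)=d\big(\delta_{k_0},E_{U_{\pm,k_0}}(\zeta)\delta_{k_0}\big)_{\ell^2([k_0,\pm\infty)\cap\mathbb{Z})},\quad \zeta\in\partial\mathbb{D},$$ where $dE_{U_{\pm,k_0}}(\cdot)$ denotes the operator-valued spectral measure of the unitary operator $U_{\pm,k_0}$, i.e. $U_{\pm,k_0}=\oint_{\partial\mathbb{D}}dE_{U_{\pm,k_0}}(\zeta)\,\zeta$.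
   Context: $\mathbb{D}$ is the open unit disk in $\mathbb{C}$ and $\partial\mathbb{D}$ the unit circle. Let $\{\alpha_k\}_{k\in\mathbb{Z}}\subset\mathbb{D}$ and $\rho_k=\sqrt{1-|\alpha_k|^2}$. Scalar products are linear in the second argument; $\{\delta_k\}$ is the standard basis; $[k_0,-\infty)\cap\mathbb{Z}$ means $(-\infty,k_0]\cap\mathbb{Z}$. CMV operators: $\theta_k=\begin{pmatrix}-\alpha_k&\rho_k\\ \rho_k&\overline{\alpha_k}\end{pmatrix}$. $V$ (resp. $W$) is the unitary operator on $\ell^2(\mathbb{Z})$ whose matrix in the standard basis is block diagonal with blocks $\theta_{2k}$ on rows/columns $2k-1,2k$ (resp. $\theta_{2k+1}$ on rows/columns $2k,2k+1$), $k\in\mathbb{Z}$, and $U=VW$. Half-lattice operators: if $\alpha_{k_0}$ is replaced by $1$ (so $\rho_{k_0}=0$), then $V,W,U$ split as direct sums with respect to $\ell^2((-\infty,k_0-1]\cap\mathbb{Z})\oplus\ell^2([k_0,\infty)\cap\mathbb{Z})$; $V_{+,k_0},W_{+,k_0},U_{+,k_0}=V_{+,k_0}W_{+,k_0}$ denote the parts on $\ell^2([k_0,\infty)\cap\mathbb{Z})$. Similarly, replacing $\alpha_{k_0+1}$ by $1$, $V_{-,k_0},W_{-,k_0},U_{-,k_0}=V_{-,k_0}W_{-,k_0}$ denote the parts on $\ell^2((-\infty,k_0]\cap\mathbb{Z})$. Transfer matrices: for $z\in\mathbb{C}\setminus\{0\}$, $T(z,k)=\frac1{\rho_k}\begin{pmatrix}\alpha_k&z\\1/z&\overline{\alpha_k}\end{pmatrix}$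 for $k$ odd and $T(z,k)=\frac1{\rho_k}\begin{pmatrix}\overline{\alpha_k}&1\\1&\alpha_k\end{pmatrix}$ for $k$ even. The Laurent polynomials $p_\pm(z,k,k_0),r_\pm(z,k,k_0)$, $k\in\mathbb{Z}$, are the components $(u,v)=(p_\pm,r_\pm)$ of the solutions of $\binom{u(z,k)}{v(z,k)}=T(z,k)\binom{u(z,k-1)}{v(z,k-1)}$, $k\in\mathbb{Z}$, with initial values at $k=k_0$: $\binom{p_+}{r_+}=\binom{z}{1}$ for $k_0$ odd and $\binom11$ for $k_0$ even; $\binom{p_-}{r_-}=\binom{1}{-1}$ for $k_0$ odd and $\binom{-z}{1}$ for $k_0$ even. *)

(* Defs.v *)
From HB Require Import structures.
From mathcomp Require Import all_boot all_order all_algebra.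
From mathcomp Require Import complex.
From mathcomp Require Import all_classical all_reals all_analysis.

Set Implicit Arguments.
Unset Strict Implicit.
Unset Printing Implicit Defensive.

Import Order.TTheory GRing.Theory Num.Theory.
Import numFieldNormedType.Exports.
Import ComplexField.Normc.

Local Open Scope classical_set_scope.
Local Open Scope ring_scope.
Local Open Scope complex_scope.

(* The discrete sigma-algebra, so that l^2(Z) is L^2 of the counting measure. *)
HB.instance Definition _ := isPointed.Build int 0.
HB.instance Definition _ := @isMeasurable.Build default_measure_display
  int discrete_measurable discrete_measurable0
  discrete_measurableC discrete_measurableU.

Definition circle (R : realType) := {z : R[i] | `|z| == 1}.
HB.instance Definition _ (R : realType) := Choice.on (circle R).
HB.instance Definition _ (R : realType) :=
  isPointed.Build (circle R) (exist _ 1 (introT eqP (normr1 R[i]))).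

(* Relatively open subsets; R[i]^o carries the topology of the norm. *)
Definition circle_open (R : realType) : set (set (circle R)) :=
  [set A | exists2 O : set R[i]^o, open O & A = [set zeta | O (val zeta)]].

Definition circle_borel (R : realType) := g_sigma_algebraType (@circle_open R).

(* mu is not required to be bundled as a measure, because the set functions
   A |-> (f, E(A) f) below come unbundled; the library integral evaluates mu
   on measurable sets only. *)
Section ComplexL2.
Context d (T : measurableType d) (R : realType) (mu : set T -> \bar R).
Implicit Types f g : T -> R[i].

Definition cmeasurable f : Prop :=
  measurable_fun setT (fun x => complex.Re (f x)) /\
  measurable_fun setT (fun x => complex.Im (f x)).

Definition cintegral f : R[i] :=
  fine (\int[mu]_x (complex.Re (f x))%:E)%E
  +i* fine (\int[mu]_x (complex.Im (f x))%:E)%E.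

Definition sqnorm f : \bar R := (\int[mu]_x (normc (f x) ^+ 2)%:E)%E.

Definition L2 f : Prop := cmeasurable f /\ (sqnorm f < +oo)%E.

Definition ip f g : R[i] := cintegral (fun x => (f x)^* * g x).

(* The family (e k), k in I, consists of orthonormal elements of L^2 and its
   closed linear span is L^2. *)
Definition orthonormal_basis (I : set int) (e : int -> T -> R[i]) : Prop :=
  [/\ forall k, I k -> L2 (e k),
      forall j k, I j -> I k -> ip (e j) (e k) = (j == k)%:R &
      forall f, L2 f -> forall eps : R, 0 < eps ->
        exists (s : seq int) (c : int -> R[i]),
          (forall k, k \in s -> I k) /\
          (sqnorm (fun x => (f x - \sum_(k <- s) c k * e k x)%R) < eps%:E)%E].

End ComplexL2.

Section SpectralMeasure.
Context (R : realType).
Implicit Types (J : set int) (f g : int -> R[i]).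

Definition l2ip f g : R[i] := ip (@counting int R) f g.

(* l^2(J), as the subspace of l^2(Z) of the sequences vanishing off J. *)
Definition l2 J f : Prop :=
  L2 (@counting int R) f /\ (forall k, ~ J k -> f k = 0).

Definition delta (k0 : int) : int -> R[i] := fun k => (k == k0)%:R.

(* Operators on l^2(J) are functions on sequences, of which only the values on
   l^2(J) matter. *)
Definition operator := (int -> R[i]) -> (int -> R[i]).

(* A |-> (f, E(A) f); this scalar product is real when E(A) is a projection. *)
Definition diagonal_measure (E : set (circle_borel R) -> operator) f :
    set (circle_borel R) -> \bar R :=
  fun A => (complex.Re (l2ip f (E A f)))%:E.

(* The integral of zeta against the complex measure A |-> (f, E(A) g), written
   by polarization in terms of the positive measures of f + i^n g, n < 4. *)
Definition weak_integral_id (E : set (circle_borel R) -> operator) f g : R[i] :=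
  4^-1 * \sum_(n < 4) (- 'i) ^+ n *
    cintegral (diagonal_measure E (fun k => f k + 'i ^+ n * g k))
              (fun zeta => val zeta).

(* E is a projection-valued measure on the Borel sets of the unit circle, with
   values in the orthogonal projections of l^2(J), and U is the integral of
   zeta dE(zeta) in the weak sense. *)
Record spectral_measure J (U : operator)
    (E : set (circle_borel R) -> operator) : Prop := SpectralMeasure {
  spectral_stable : forall A, measurable A -> forall f, l2 J f -> l2 J (E A f);
  spectral_linear : forall A, measurable A ->
    forall (a : R[i]) f g, l2 J f -> l2 J g ->
    E A (fun k => a * f k + g k) = (fun k => a * E A f k + E A g k);
  spectral_selfadjoint : forall A, measurable A ->
    forall f g, l2 J f -> l2 J g -> l2ip f (E A g) = l2ip (E A f) g;
  spectral_setT : forall f, l2 J f -> E setT f = f;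
  (* with A = B, each E A is idempotent *)
  spectral_setI : forall A B, measurable A -> measurable B ->
    forall f, l2 J f -> E (A `&` B) f = E A (E B f);
  spectral_sigma_additive : forall F : nat -> set (circle_borel R),
    (forall n, measurable (F n)) -> trivIset setT F ->
    forall f, l2 J f ->
    (fun n => sqnorm (@counting int R) (fun k =>
       E (\bigcup_m F m) f k - \sum_(m < n) E (F m) f k)) @ \oo --> 0%E;
  spectral_integral : forall f g, l2 J f -> l2 J g ->
    l2ip f (U g) = weak_integral_id E f g }.

End SpectralMeasure.

Definition evenz (k : int) : bool := (2 %| k)%Z.
Definition oddz (k : int) : bool := ~~ evenz k.

Section CMV.
Context (R : realType).
Implicit Types (alpha : int -> R[i]) (z : R[i]) (k : int).

Definition mx2 (a b c d : R[i]) : 'M[R[i]]_2 :=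
  \matrix_(i, j) if i == 0 then (if j == 0 then a else b)
                 else (if j == 0 then c else d).

Definition cv2 (a b : R[i]) : 'cV[R[i]]_2 :=
  \col_i if i == 0 then a else b.

Definition rho alpha k : R := Num.sqrt (1 - normc (alpha k) ^+ 2).

Definition theta alpha k : 'M[R[i]]_2 :=
  mx2 (- alpha k) (rho alpha k)%:C (rho alpha k)%:C (alpha k)^*.

(* The block diagonal matrix with block theta_m on the rows and columns m-1, m,
   for all m of the given parity P: the row k is the lower row of theta_k when
   k satisfies P, and the upper row of theta_(k+1) otherwise. *)
Definition block_operator (P : pred int) alpha : operator R := fun f k =>
  if P k then theta alpha k 1 0 * f (k - 1) + theta alpha k 1 1 * f k
  else theta alpha (k + 1) 0 0 * f k + theta alpha (k + 1) 0 1 * f (k + 1).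

Definition Vop alpha : operator R := block_operator evenz alpha.
Definition Wop alpha : operator R := block_operator oddz alpha.
Definition Uop alpha : operator R := Vop alpha \o Wop alpha.

Definition half_plus (k0 : int) : set int := [set k | k0 <= k].
Definition half_minus (k0 : int) : set int := [set k | k <= k0].

Definition set_one alpha (m : int) : int -> R[i] :=
  fun k => if k == m then 1 else alpha k.

(* The parts on l^2(half_plus k0) and l^2(half_minus k0): the modified
   operators leave these subspaces of l^2(Z) invariant (see below). *)
Definition U_plus alpha (k0 : int) : operator R := Uop (set_one alpha k0).
Definition U_minus alpha (k0 : int) : operator R := Uop (set_one alpha (k0 + 1)).

Definition transfer alpha z k : 'M[R[i]]_2 :=
  ((rho alpha k)^-1)%:C *:
    (if oddz k then mx2 (alpha k) z z^-1 (alpha k)^*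
     else mx2 (alpha k)^* 1 1 (alpha k)).

Fixpoint transfer_forward alpha z (k0 : int) (w : 'cV[R[i]]_2) (n : nat) :=
  if n is m.+1
  then transfer alpha z (k0 + m.+1%:Z) *m transfer_forward alpha z k0 w m
  else w.

Fixpoint transfer_backward alpha z (k0 : int) (w : 'cV[R[i]]_2) (n : nat) :=
  if n is m.+1
  then invmx (transfer alpha z (k0 - m%:Z)) *m transfer_backward alpha z k0 w m
  else w.

(* The solution of y(k) = T(z,k) y(k-1), k in Z, with y(k0) = w. *)
Definition transfer_solution alpha z (k0 : int) w k : 'cV[R[i]]_2 :=
  match k - k0 with
  | Posz n => transfer_forward alpha z k0 w n
  | Negz n => transfer_backward alpha z k0 w n.+1
  end.

Definition init_plus z (k0 : int) : 'cV[R[i]]_2 :=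
  if oddz k0 then cv2 z 1 else cv2 1 1.
Definition init_minus z (k0 : int) : 'cV[R[i]]_2 :=
  if oddz k0 then cv2 1 (-1) else cv2 (- z) 1.

Definition p_plus alpha z k (k0 : int) : R[i] :=
  transfer_solution alpha z k0 (init_plus z k0) k 0 0.
Definition r_plus alpha z k (k0 : int) : R[i] :=
  transfer_solution alpha z k0 (init_plus z k0) k 1 0.
Definition p_minus alpha z k (k0 : int) : R[i] :=
  transfer_solution alpha z k0 (init_minus z k0) k 0 0.
Definition r_minus alpha z k (k0 : int) : R[i] :=
  transfer_solution alpha z k0 (init_minus z k0) k 1 0.

Lemma transfer_solution_init alpha z k0 w :
  transfer_solution alpha z k0 w k0 = w.
Proof. by rewrite /transfer_solution subrr. Qed.

Lemma rho_gt0 alpha k : `|alpha k| < 1 -> 0 < rho alpha k.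
Proof.
move=> h; rewrite /rho sqrtr_gt0 subr_gt0.
have h' : normc (alpha k) < 1 by rewrite -ltcR -[_%:C]/(`|alpha k|).
by rewrite expr_lt1 // /normc; case: (alpha k) => a b; rewrite sqrtr_ge0.
Qed.


Lemma transfer_unitmx alpha z k :
  `|alpha k| < 1 -> z != 0 -> transfer alpha z k \in unitmx.
Proof.
move=> h z0; have r0 := rho_gt0 h.
have rU : ((rho alpha k)^-1)%:C != 0 :> R[i].
  by rewrite fmorph_eq0 invr_eq0 gt_eqF.
have dU : `|alpha k| ^+ 2 - 1 != 0 :> R[i].
  by rewrite lt_eqF // subr_lt0 expr_lt1.
have det2 a b c d : \det (mx2 a b c d) = a * d - b * c.
  rewrite (expand_det_row _ ord0) !big_ord_recl big_ord0 /cofactor !det_mx11.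
  by rewrite !mxE /= addr0 expr0 expr1 mul1r mulN1r mulrN.
rewrite unitmxE /transfer detZ unitfE mulf_neq0 ?expf_neq0 //.
rewrite sqr_normc in dU.
case: (oddz k); rewrite det2 ?divff // ?mulr1 //.
by rewrite mulrC.
Qed.

Lemma transfer_solution_rec alpha z (k0 : int) w k :
    (forall j, `|alpha j| < 1) -> z != 0 ->
  transfer_solution alpha z k0 w k =
  transfer alpha z k *m transfer_solution alpha z k0 w (k - 1).
Proof.
move=> h z0; rewrite /transfer_solution addrAC.
have : k = k0 + (k - k0) by rewrite addrC subrK.
case: (k - k0) => [[|m]|m] -> /=.
- by rewrite subr0 mulmxA mulmxV ?mul1mx //; exact: transfer_unitmx.
- by rewrite subn1.
- by rewrite addn0 NegzE [RHS]mulmxA mulmxV ?mul1mx //; exact: transfer_unitmx.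
Qed.

(* With alpha_m = 1, the block theta_m is diagonal, so that V and W do not
   couple the sites m - 1 and m. *)
Lemma theta_set_one alpha m :
  theta (set_one alpha m) m = mx2 (-1) 0 0 1.
Proof.
by rewrite /theta /rho /set_one eqxx normc1 expr1n subrr sqrtr0 conjc1.
Qed.

Lemma block_plus P alpha (k0 : int) (f : int -> R[i]) :
  (forall k, ~ half_plus k0 k -> f k = 0) ->
  forall k, ~ half_plus k0 k -> block_operator P (set_one alpha k0) f k = 0.
Proof.
move=> f0 k /negP; rewrite -ltNge => kk0.
have fk j : j < k0 -> f j = 0 by move=> jk; apply/f0/negP; rewrite -ltNge.
rewrite /block_operator; case: ifP => _.
  by rewrite !fk ?mulr0 ?addr0 // ltrBlDr (lt_trans kk0) // ltrDl.
rewrite (fk k) // mulr0 add0r.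
have [k1|k1] := ltP (k + 1) k0; first by rewrite fk ?mulr0.
have -> : k + 1 = k0 by apply/eqP; rewrite eq_le k1 andbT lezD1.
by rewrite theta_set_one mxE /= mul0r.
Qed.

Lemma block_minus P alpha (k0 : int) (f : int -> R[i]) :
  (forall k, ~ half_minus k0 k -> f k = 0) ->
  forall k, ~ half_minus k0 k ->
  block_operator P (set_one alpha (k0 + 1)) f k = 0.
Proof.
move=> f0 k /negP; rewrite -ltNge => kk0.
have fk j : k0 < j -> f j = 0 by move=> jk; apply/f0/negP; rewrite -ltNge.
rewrite /block_operator; case: ifP => _; last first.
  by rewrite !fk ?mulr0 ?addr0 // (lt_trans kk0) // ltrDl.
rewrite (fk k) // mulr0 addr0.
have [k1|k1] := ltP k0 (k - 1); first by rewrite fk ?mulr0.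
have -> : k = k0 + 1 by apply/eqP; rewrite eq_le lezD1 kk0 andbT -lerBlDr.
by rewrite theta_set_one mxE /= mul0r.
Qed.

Lemma U_plus_half alpha (k0 : int) (f : int -> R[i]) :
  (forall k, ~ half_plus k0 k -> f k = 0) ->
  forall k, ~ half_plus k0 k -> U_plus alpha k0 f k = 0.
Proof. by move=> f0; do 2!apply: block_plus. Qed.

Lemma U_minus_half alpha (k0 : int) (f : int -> R[i]) :
  (forall k, ~ half_minus k0 k -> f k = 0) ->
  forall k, ~ half_minus k0 k -> U_minus alpha k0 f k = 0.
Proof. by move=> f0; do 2!apply: block_minus. Qed.

End CMV.

(* Main.v *)
(** On L^2(mu), mu the diagonal measure at delta_k0, there is an isometry into
    l^2(J) that sends the function 1 to delta_k0 and intertwines multiplication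
    by zeta with U: it is the closure of h |-> S delta_k0, where h runs over the
    simple functions and S is the integral of h against E.

    On the circle put H_k = conj(p_k) p_k0 and G_k = conj(r_k) p_k0.  The
    transfer recursion says that (G_(k-1), G_k) = theta_k (H_(k-1), H_k) for k
    even and zeta (H_(k-1), H_k) = theta_k (G_(k-1), G_k) for k odd.  By
    definition of V and W, the vectors delta_k and V delta_k satisfy the same
    relations, with U in place of zeta, and the initial values are those given
    at k0 by the degenerate block.  Hence, by induction from k0, the isometry
    sends H_k to delta_k and G_k to V delta_k, for k in J; both families of
    vectors are orthonormal bases of l^2(J).  Completeness in L^2(mu) follows as
    simple functions are dense there and their images are limits of finite
    combinations of delta_k, or of V delta_k. *)
Require Import Defs.
From HB Require Import structures.
From mathcomp Require Import all_boot all_order all_algebra.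
From mathcomp Require Import complex ring lra.
From mathcomp Require Import all_classical all_reals all_analysis.
From mathcomp Require Import measurable_realfun.

Set Implicit Arguments.
Unset Strict Implicit.
Unset Printing Implicit Defensive.

Import Order.TTheory GRing.Theory Num.Theory.
Import numFieldNormedType.Exports.
Import ComplexField.Normc.
Local Open Scope classical_set_scope.
Local Open Scope ring_scope.
Local Open Scope complex_scope.
(* Without these two lines the same symbols denote, depending on the context,
   conjc or Num.conj and Complex 0 1 or Num.imaginary. *)
Local Notation "z ^*" := (Num.conj z) : complex_scope.
Local Notation "''i'" := (Num.imaginary) : complex_scope.

(** The conjugates are forced: solving the recursion at even k for r_(k-1) gives - conj(alpha_k)
    p_(k-1) + rho_k p_k, whereas V delta_(k-1) carries - alpha_k. The factor p_k0 is unimodular on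
    the circle and makes H_k0 the constant 1; the map q |-> conj(q) p_k0 is antiunitary on L^2(mu),
    so it respects orthonormal bases. The main obstacle is that U is tied to E only through the
    scalar products (f, U g), expressed by the measures of f + i^n g; neither unitarity nor
    continuity of U is given. Hence U is compared, one vector g at a time, with the integral Z of a
    simple function close to zeta, by testing U g - Z g against itself. Going back from U g to g
    uses the adjoint of Z in place of an inverse of U. The isometry is never built as a map: a
    relation between functions and vectors, stable under the operations needed, avoids classes
    modulo null functions and limits of Cauchy sequences. Cyclicity of delta_k0 needs no separate
    proof, since the induction exhibits a function for every delta_k. *)

Section ComplexFacts.
Context (R : realType).
Implicit Types x y z : R[i].
Notation re := (@complex.Re R).
Notation im := (@complex.Im R).

(** * Complex arithmetic through real and imaginary parts *)

Lemma ReD x y : re (x + y) = re x + re y. Proof. by case: x y => ? ? []. Qed.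
Lemma ImD x y : im (x + y) = im x + im y. Proof. by case: x y => ? ? []. Qed.
Lemma ReM x y : re (x * y) = re x * re y - im x * im y.
Proof. by case: x y => ? ? []. Qed.
Lemma ImM x y : im (x * y) = re x * im y + im x * re y.
Proof. by case: x y => ? ? []. Qed.
Lemma ReJ x : re x^* = re x. Proof. by case: x. Qed.
Lemma ImJ x : im x^* = - im x. Proof. by case: x. Qed.

Lemma normc_sqr x : normc x ^+ 2 = re x ^+ 2 + im x ^+ 2.
Proof. by case: x => a b /=; rewrite sqr_sqrtr // addr_ge0 ?sqr_ge0. Qed.

Lemma normc_ge0 x : 0 <= normc x.
Proof. by case: x => a b /=; rewrite sqrtr_ge0. Qed.

Lemma normcJ x : normc x^* = normc x.
Proof. by case: x => a b /=; rewrite sqrrN. Qed.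

Lemma normcC (a : R) : normc a%:C = `|a|.
Proof. by rewrite /= expr0n addr0 sqrtr_sqr. Qed.

Lemma normc_Re x : `|re x| <= normc x.
Proof.
rewrite -(@ler_pXn2r R 2) ?nnegrE ?normr_ge0 ?normc_ge0//.
by rewrite normc_sqr real_normK ?num_real// lerDl sqr_ge0.
Qed.

Lemma normc_Im x : `|im x| <= normc x.
Proof.
rewrite -(@ler_pXn2r R 2) ?nnegrE ?normr_ge0 ?normc_ge0//.
by rewrite normc_sqr real_normK ?num_real// lerDr sqr_ge0.
Qed.

Lemma normc_le_ReIm x : normc x <= `|re x| + `|im x|.
Proof.
rewrite -(@ler_pXn2r R 2) ?nnegrE ?addr_ge0 ?normc_ge0// normc_sqr.
by rewrite sqrrD !real_normK ?num_real// lerD2r lerDl mulrn_wge0 ?mulr_ge0.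
Qed.

Lemma normcD x y : normc (x + y) <= normc x + normc y.
Proof.
have := ler_normD x y.
by rewrite -[`|x + y|]/((normc (x + y))%:C) -[`|x|]/((normc x)%:C)
  -[`|y|]/((normc y)%:C) -rmorphD lecR.
Qed.

Lemma normc_distC x y : normc (x - y) = normc (y - x).
Proof. by rewrite -normcN opprB. Qed.

Lemma mulJc x : x^* * x = (normc x ^+ 2)%:C.
Proof.
rewrite normc_sqr; case: x => a b; apply/eqP; rewrite eq_complex /=.
by apply/andP; split; apply/eqP; ring.
Qed.

Lemma conjcX x n : (x ^+ n)^* = x^* ^+ n.
Proof. exact: rmorphXn. Qed.

Lemma conj_i : ('i : R[i])^* = - 'i.
Proof. by apply/eqP; rewrite eq_complex /= oppr0 !eqxx. Qed.

Lemma sqr_i_c : ('i : R[i]) * 'i = -1.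
Proof.
by apply/eqP; rewrite eq_complex /= !mul0r !mulr0 mul1r sub0r add0r oppr0 !eqxx.
Qed.

Lemma normc_iX n : normc ('i ^+ n : R[i]) = 1.
Proof.
elim: n => [|n IH]; first by rewrite expr0 normc1.
by rewrite exprS normcM IH mulr1 /= expr0n add0r expr1n sqrtr1.
Qed.

(** The coefficient of b sums to 4; those of a and d are sums of (-i)^n and that of c is a sum of
    (-1)^n, all zero over a period. With the four scalar products of f and g in place of a, b, c, d
    this is polarization. *)
Lemma sum_polar (a b c d : R[i]) :
  4^-1 * \sum_(n < 4) (- 'i) ^+ n * (a + 'i ^+ n * b + ('i ^+ n)^* * c
     + ('i ^+ n)^* * 'i ^+ n * d) = b.
Proof.
have := conj_i; have := sqr_i_c; move: ('i : R[i]) => i ii ij.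
under eq_bigr do rewrite !conjcX ij.
rewrite !big_ord_recl big_ord0 /= /bump /=.
rewrite (_ : ((1 + (1 + (1 + 0)) = 3)%N)) // (_ : ((1 + (1 + 0) = 2)%N)) //.
rewrite (_ : ((1 + 0 = 1)%N)) // !expr0.
have i3 : i ^+ 3 = - i by rewrite exprS expr2 ii mulrN1.
have i2 : i ^+ 2 = -1 by rewrite expr2.
rewrite !expr1 [(- i) ^+ 2]sqrrN [(- i) ^+ 3]exprNn i3 i2.
have -> : (-1) ^+ 3 * - i = i :> R[i] by rewrite -signr_odd /= expr1 mulN1r opprK.
have -> : 1 * (a + 1 * b + 1 * c + 1 * 1 * d) +
  (- i * (a + i * b + - i * c + - i * i * d) +
   (-1 * (a + -1 * b + -1 * c + -1 * -1 * d) +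
    (i * (a + - i * b + i * c + i * - i * d) + 0))) =
  2 * b + 2 * c + (i * i) * (2 * c - 2 * b) :> R[i] by ring.
rewrite ii; have n4 : (4 : R[i]) != 0 by rewrite pnatr_eq0.
by field.
Qed.

End ComplexFacts.

(** * Two facts on real numbers *)

Section RealFacts.
Context (R : realType).
Implicit Types a b r t : R.

(** The quadratic has its minimum b^2 - r^2 / a^2 at t = r / a^2. For a = 0 it is affine, and for r
    > 0 it takes the value -1 at t = (b^2 + 1) / (2 r). *)
Lemma quadratic_discriminant a b r : 0 <= a -> 0 <= b ->
  (forall t, 0 <= a ^+ 2 * t ^+ 2 - 2 * t * r + b ^+ 2) -> r <= a * b.
Proof.
move=> a0 b0 H; have [r0|r0] := leP r 0; first by rewrite (le_trans r0)// mulr_ge0.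
have [aE|aN0] := eqVneq a 0.
  rewrite aE in H *.
  have := H ((b ^+ 2 + 1) / (2 * r)).
  have -> : 0 ^+ 2 * ((b ^+ 2 + 1) / (2 * r)) ^+ 2 -
    2 * ((b ^+ 2 + 1) / (2 * r)) * r + b ^+ 2 = -1 :> R by
    rewrite expr0n /=; field; rewrite gt_eqF.
  by rewrite lerNr oppr0 ler10.
have a2 : 0 < a ^+ 2 by rewrite exprn_even_gt0.
rewrite -(@ler_pXn2r R 2) ?nnegrE ?mulr_ge0 ?(ltW r0)//.
have := H (r / a ^+ 2).
have -> : a ^+ 2 * (r / a ^+ 2) ^+ 2 - 2 * (r / a ^+ 2) * r + b ^+ 2 =
  (a ^+ 2 * b ^+ 2 - r ^+ 2) / a ^+ 2 by field.
by rewrite pmulr_lge0 ?invr_gt0// subr_ge0 exprMn.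
Qed.

Lemma eq_of_dist_lt a b : (forall e, 0 < e -> `|a - b| <= e) -> a = b.
Proof.
move=> H; apply/eqP; rewrite -subr_eq0 -normr_le0.
by apply/ler_addgt0Pr => e /H; rewrite add0r.
Qed.

End RealFacts.

(** * Complex L^2 spaces: scalar product, norm, Cauchy-Schwarz, polarization *)

Section L2Theory.
Context d (T : measurableType d) (R : realType) (mu : {measure set T -> \bar R}).
Implicit Types (f g h : T -> R[i]) (a : R[i]).

Lemma cmeasurable_cst a : cmeasurable (fun _ : T => a).
Proof. by split; exact: measurable_cst. Qed.

Lemma cmeasurableD f g :
  cmeasurable f -> cmeasurable g -> cmeasurable (fun x => f x + g x).
Proof.
move=> [f1 f2] [g1 g2]; split.
  by under eq_fun do rewrite ReD; exact: measurable_funD.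
by under eq_fun do rewrite ImD; exact: measurable_funD.
Qed.

Lemma cmeasurableM f g :
  cmeasurable f -> cmeasurable g -> cmeasurable (fun x => f x * g x).
Proof.
move=> [f1 f2] [g1 g2]; split.
  under eq_fun do rewrite ReM.
  by apply: measurable_funB; exact: measurable_funM.
under eq_fun do rewrite ImM.
by apply: measurable_funD; exact: measurable_funM.
Qed.

Lemma cmeasurableZ a f : cmeasurable f -> cmeasurable (fun x => a * f x).
Proof. by apply: cmeasurableM; exact: cmeasurable_cst. Qed.

Lemma cmeasurableJ f : cmeasurable f -> cmeasurable (fun x => (f x)^*).
Proof.
move=> [f1 f2]; split.
  by under eq_fun do rewrite ReJ.
under eq_fun do rewrite ImJ.
by apply: (measurableT_comp _ f2); exact: oppr_measurable.
Qed.

Lemma cmeasurable_indic (A : set T) :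
  measurable A -> cmeasurable (fun x => (\1_A x : R)%:C).
Proof.
move=> mA; split => /=; last exact: measurable_cst.
exact: measurable_indic.
Qed.

Lemma measurable_normc_sqr f :
  cmeasurable f -> measurable_fun setT (fun x => normc (f x) ^+ 2).
Proof.
move=> [f1 f2]; under eq_fun do rewrite normc_sqr.
by apply: measurable_funD; apply: measurable_funX.
Qed.

Lemma measurable_normc f :
  cmeasurable f -> measurable_fun setT (fun x => normc (f x)).
Proof.
move=> mf; have -> : (fun x => normc (f x)) = Num.sqrt \o (fun x => normc (f x) ^+ 2).
  by apply/funext => x /=; rewrite sqrtr_sqr ger0_norm// normc_ge0.
apply: measurableT_comp (measurable_normc_sqr mf).
by apply: continuous_measurable_fun; exact: sqrt_continuous.
Qed.

Lemma sqnorm_ge0 f : (0 <= sqnorm mu f)%E.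
Proof. by apply: integral_ge0 => x _; rewrite lee_fin sqr_ge0. Qed.

Lemma le_sqnorm f g (C : R) : cmeasurable f -> cmeasurable g -> 0 <= C ->
    (forall x, normc (f x) <= C * normc (g x)) ->
  (sqnorm mu f <= (C ^+ 2)%:E * sqnorm mu g)%E.
Proof.
move=> mf mg C0 fg; rewrite /sqnorm -ge0_integralZl_EFin//=; last first.
- by rewrite sqr_ge0.
- exact/measurable_EFinP/measurable_normc_sqr.
- by move=> x _; rewrite lee_fin sqr_ge0.
apply: ge0_le_integral => //.
- by move=> x _; rewrite lee_fin sqr_ge0.
- exact/measurable_EFinP/measurable_normc_sqr.
- under eq_fun do rewrite -EFinM.
  by apply/measurable_EFinP/measurable_funM => //; exact: measurable_normc_sqr.
- move=> x _; rewrite -EFinM lee_fin -exprMn lerXn2r ?nnegrE ?mulr_ge0 ?normc_ge0//.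
Qed.

Lemma L2_bounded f g (C : R) : cmeasurable f -> 0 <= C ->
  (forall x, normc (f x) <= C * normc (g x)) -> L2 mu g -> L2 mu f.
Proof.
move=> mf C0 fg [mg g2]; split=> //.
by rewrite (le_lt_trans (le_sqnorm mf mg C0 fg))// lte_mul_pinfty// lee_fin sqr_ge0.
Qed.

Lemma L2Z a f : L2 mu f -> L2 mu (fun x => a * f x).
Proof.
move=> L; apply: (L2_bounded _ (normc_ge0 a) _ L).
  by apply: cmeasurableZ; case: L.
by move=> x; rewrite normcM.
Qed.

Lemma L20 : L2 mu (fun _ => 0 : R[i]).
Proof.
split; first exact: cmeasurable_cst.
rewrite /sqnorm (_ : (fun _ => _) = cst 0%E) ?integral0//.
by apply/funext => x; rewrite normc0 expr0n.
Qed.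

(** The difference of the two sides is |x - y|^2. *)
Lemma sqr_normcD (x y : R[i]) :
  normc (x + y) ^+ 2 <= 2 * normc x ^+ 2 + 2 * normc y ^+ 2.
Proof.
rewrite !normc_sqr ReD ImD -subr_ge0.
set a := complex.Re x; set b := complex.Re y; set c := complex.Im x.
set e := complex.Im y.
have -> : 2 * (a ^+ 2 + c ^+ 2) + 2 * (b ^+ 2 + e ^+ 2) -
  ((a + b) ^+ 2 + (c + e) ^+ 2) = (a - b) ^+ 2 + (c - e) ^+ 2 by ring.
by rewrite addr_ge0 ?sqr_ge0.
Qed.

Lemma L2D f g : L2 mu f -> L2 mu g -> L2 mu (fun x => f x + g x).
Proof.
move=> [mf f2] [mg g2]; split; first exact: cmeasurableD.
have m2 h : cmeasurable h -> measurable_fun setT (fun x => (2 * normc (h x) ^+ 2)%:E).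
  by move=> mh; apply/measurable_EFinP/measurable_funM => //;
    exact: measurable_normc_sqr.
apply: (@le_lt_trans _ _ (2%:E * sqnorm mu f + 2%:E * sqnorm mu g)%E); last first.
  by rewrite lte_add_pinfty// lte_mul_pinfty.
rewrite /sqnorm -!ge0_integralZl_EFin//=;
  try (by move=> x _; rewrite lee_fin sqr_ge0);
  try exact/measurable_EFinP/measurable_normc_sqr.
rewrite -ge0_integralD//=; last first.
- exact: m2.
- by move=> x _; rewrite mule_ge0// lee_fin sqr_ge0.
- exact: m2.
- by move=> x _; rewrite mule_ge0// lee_fin sqr_ge0.
apply: ge0_le_integral => //.
- by move=> x _; rewrite lee_fin sqr_ge0.
- exact/measurable_EFinP/measurable_normc_sqr/cmeasurableD.
- by apply: emeasurable_funD; exact: m2.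
- by move=> x _; rewrite -!EFinM -EFinD lee_fin sqr_normcD.
Qed.

Lemma L2B f g : L2 mu f -> L2 mu g -> L2 mu (fun x => f x - g x).
Proof.
move=> Lf Lg; have := L2D Lf (L2Z (-1) Lg).
by under eq_fun do rewrite mulN1r.
Qed.

Lemma L2_sum (I : eqType) (s : seq I) (F : I -> T -> R[i]) :
  (forall i, i \in s -> L2 mu (F i)) -> L2 mu (fun x => \sum_(i <- s) F i x).
Proof.
elim: s => [|i s IH] LF.
  by under eq_fun do rewrite big_nil; exact: L20.
under eq_fun do rewrite big_cons.
by apply: L2D; [apply: LF; rewrite mem_head|apply: IH => j js;
  apply: LF; rewrite inE js orbT].
Qed.

Definition cintegrable f := mu.-integrable setT (fun x => (complex.Re (f x))%:E) /\
  mu.-integrable setT (fun x => (complex.Im (f x))%:E).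

Lemma cintegralE f : cintegral mu f =
  (\int[mu]_x complex.Re (f x))%R +i* (\int[mu]_x complex.Im (f x))%R.
Proof. by []. Qed.

Lemma cintegrableZ a f : cintegrable f -> cintegrable (fun x => a * f x).
Proof.
move=> [f1 f2]; split.
  under eq_fun do rewrite ReM EFinB !EFinM.
  by apply: integrableB => //; exact: integrableZl.
under eq_fun do rewrite ImM EFinD !EFinM.
by apply: integrableD => //; exact: integrableZl.
Qed.

Lemma cintegralD f g : cintegrable f -> cintegrable g ->
  cintegral mu (fun x => f x + g x) = cintegral mu f + cintegral mu g.
Proof.
move=> [f1 f2] [g1 g2]; rewrite !cintegralE; apply/eqP; rewrite eq_complex /=.
rewrite -!RintegralD//; apply/andP; split; apply/eqP; apply: eq_Rintegral => x _.
  exact: ReD.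
exact: ImD.
Qed.

Lemma cintegralZ a f : cintegrable f ->
  cintegral mu (fun x => a * f x) = a * cintegral mu f.
Proof.
move=> [f1 f2]; rewrite !cintegralE; case: a => a b; apply/eqP.
have iZ (c : R) (k : T -> R) : mu.-integrable setT (fun x => (k x)%:E) ->
  mu.-integrable setT (EFin \o (fun x => c * k x)).
  by move=> ih; rewrite /comp; under eq_fun do rewrite EFinM; exact: integrableZl.
rewrite eq_complex /= -!RintegralZl// -RintegralB//; [|exact: iZ..].
rewrite -RintegralD//; [|exact: iZ..].
by apply/andP; split; apply/eqP; apply: eq_Rintegral => x _; case: (f x).
Qed.

Lemma cintegralJ f : cintegrable f ->
  cintegral mu (fun x => (f x)^*) = (cintegral mu f)^*.
Proof.
move=> [f1 f2]; rewrite !cintegralE; apply/eqP; rewrite eq_complex /=.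
rewrite -[- _]mulN1r -RintegralZl//.
by apply/andP; split; apply/eqP; apply: eq_Rintegral => x _;
  case: (f x) => //= u v; rewrite mulN1r.
Qed.

(** Since u v <= u^2 + v^2, the function k is dominated by |f|^2 + |g|^2. A real k covers the real
    and imaginary parts of conj(f) g as well as |f|^2. *)
Lemma integrable_L2M f g (k : T -> R) : L2 mu f -> L2 mu g ->
  measurable_fun setT k -> (forall x, `|k x| <= normc (f x) * normc (g x)) ->
  mu.-integrable setT (fun x => (k x)%:E).
Proof.
move=> [mf f2] [mg g2] mk hfg.
have iS h : cmeasurable h -> (sqnorm mu h < +oo)%E ->
    mu.-integrable setT (fun x => (normc (h x) ^+ 2)%:E).
  move=> mh h2; apply/integrableP; split.
    exact/measurable_EFinP/measurable_normc_sqr.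
  rewrite (_ : (fun x => _) = (fun x => (normc (h x) ^+ 2)%:E))//.
  by apply/funext => x; rewrite abse_EFin ger0_norm ?sqr_ge0.
apply: (le_integrable _ _ _ (integrableD measurableT (iS _ mf f2) (iS _ mg g2))) => //.
  exact/measurable_EFinP.
move=> x _ /=; rewrite lee_fin [leRHS]ger0_norm ?addr_ge0 ?sqr_ge0//.
apply: le_trans (hfg x) _; rewrite -subr_ge0.
set u := normc (f x); set v := normc (g x).
have -> : u ^+ 2 + v ^+ 2 - u * v = ((u - v) ^+ 2 + u ^+ 2 + v ^+ 2) / 2 by field.
by rewrite divr_ge0// !addr_ge0 ?sqr_ge0.
Qed.

Lemma cintegrable_ip f g : L2 mu f -> L2 mu g ->
  cintegrable (fun x => (f x)^* * g x).
Proof.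
move=> Lf Lg; have [m1 m2] : cmeasurable (fun x => (f x)^* * g x).
  by apply: cmeasurableM; [apply: cmeasurableJ; case: Lf|case: Lg].
split; apply: (integrable_L2M Lf Lg) => // x; rewrite -(normcJ (f x)) -normcM.
  exact: normc_Re.
exact: normc_Im.
Qed.

Lemma ipDr f g h : L2 mu f -> L2 mu g -> L2 mu h ->
  ip mu f (fun x => g x + h x) = ip mu f g + ip mu f h.
Proof.
move=> Lf Lg Lh; rewrite /ip -cintegralD; [|exact: cintegrable_ip..].
by congr cintegral; apply/funext => x; rewrite mulrDr.
Qed.

Lemma ipZr a f g : L2 mu f -> L2 mu g ->
  ip mu f (fun x => a * g x) = a * ip mu f g.
Proof.
move=> Lf Lg; rewrite /ip -cintegralZ; last exact: cintegrable_ip.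
by congr cintegral; apply/funext => x; rewrite mulrCA.
Qed.

Lemma ipC f g : L2 mu f -> L2 mu g -> ip mu f g = (ip mu g f)^*.
Proof.
move=> Lf Lg; rewrite /ip -cintegralJ; last exact: cintegrable_ip.
by congr cintegral; apply/funext => x; rewrite rmorphM/= conjCK mulrC.
Qed.

Lemma ipDl f g h : L2 mu f -> L2 mu g -> L2 mu h ->
  ip mu (fun x => g x + h x) f = ip mu g f + ip mu h f.
Proof.
by move=> Lf Lg Lh; rewrite ipC ?ipDr// ?rmorphD/= -?ipC//; exact: L2D.
Qed.

Lemma ipZl a f g : L2 mu f -> L2 mu g ->
  ip mu (fun x => a * g x) f = a^* * ip mu g f.
Proof.
by move=> Lf Lg; rewrite ipC ?ipZr// ?rmorphM/= -?ipC//; exact: L2Z.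
Qed.

(** Real-valued for ease of computation; [fine] turns an infinite square norm into 0, so the norm is
    meaningful only on [L2]. *)
Definition nrm f : R := Num.sqrt (fine (sqnorm mu f)).

Lemma nrm_ge0 f : 0 <= nrm f. Proof. exact: sqrtr_ge0. Qed.

Lemma sqr_nrm f : nrm f ^+ 2 = fine (sqnorm mu f).
Proof. by rewrite sqr_sqrtr// fine_ge0// sqnorm_ge0. Qed.

Lemma sqnormE f : L2 mu f -> sqnorm mu f = (nrm f ^+ 2)%:E.
Proof.
by move=> [_ f2]; rewrite sqr_nrm fineK// ge0_fin_numE// sqnorm_ge0.
Qed.

Lemma ipff f : ip mu f f = (nrm f ^+ 2)%:C.
Proof.
rewrite sqr_nrm /ip /cintegral /sqnorm.
under eq_fun do rewrite mulJc/=.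
by under [X in _ +i* fine X]eq_integral do rewrite mulJc/=; rewrite integral0.
Qed.

Lemma eq_nrm f g : (forall x, normc (f x) = normc (g x)) -> nrm f = nrm g.
Proof.
by move=> fg; rewrite /nrm /sqnorm; under eq_integral do rewrite fg.
Qed.

Lemma nrmZ a f : L2 mu f -> nrm (fun x => a * f x) = normc a * nrm f.
Proof.
move=> Lf; apply/eqP.
rewrite -(@eqrXn2 _ 2) ?nrm_ge0 ?mulr_ge0 ?nrm_ge0 ?normc_ge0//; apply/eqP.
apply: complexI; rewrite -ipff ipZr ?ipZl ?ipff//; last exact: L2Z.
by rewrite mulrA [a * _]mulrC mulJc exprMn -rmorphM.
Qed.

Lemma sqr_nrmD f g : L2 mu f -> L2 mu g ->
  nrm (fun x => f x + g x) ^+ 2 =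
  nrm f ^+ 2 + 2 * complex.Re (ip mu f g) + nrm g ^+ 2.
Proof.
move=> Lf Lg; have Lfg := L2D Lf Lg.
have : ip mu (fun x => f x + g x) (fun x => f x + g x) =
  ip mu f f + (ip mu f g + (ip mu f g)^*) + ip mu g g.
  by rewrite ipDr// !ipDl// -[(_)^*]ipC// addrACA !addrA addrAC.
rewrite !ipff => /(congr1 (@complex.Re _)); rewrite !ReD ReJ /=.
by move=> ->; ring.
Qed.

(** The discriminant bound is applied to the square norm of g - t f as a quadratic in the real
    variable t. *)
Lemma Re_ip_le f g : L2 mu f -> L2 mu g ->
  complex.Re (ip mu f g) <= nrm f * nrm g.
Proof.
move=> Lf Lg; apply: quadratic_discriminant => [||t]; rewrite ?nrm_ge0//.
have := sqr_ge0 (nrm (fun x => (- t)%:C * f x + g x)).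
rewrite sqr_nrmD//; last exact: L2Z.
rewrite nrmZ// ipZl// normcC normrN exprMn real_normK ?num_real// ReM ReJ ImJ /=.
by rewrite oppr0 mul0r subr0; congr (_ <= _); ring.
Qed.

(** Multiplying g by the conjugate of w = (f, g) makes the scalar product equal to the real number
    |w|^2; a factor |w| then cancels. *)
Lemma normc_ip_le f g : L2 mu f -> L2 mu g ->
  normc (ip mu f g) <= nrm f * nrm g.
Proof.
move=> Lf Lg; set w := ip mu f g.
have [->|w0] := eqVneq (normc w) 0; first by rewrite mulr_ge0 ?nrm_ge0.
have wp : 0 < normc w by rewrite lt_neqAle eq_sym w0 normc_ge0.
have := Re_ip_le Lf (L2Z (w^*) Lg).
by rewrite ipZr// -/w mulJc nrmZ// normcJ mulrCA [complex.Re _]/= expr2 ler_pM2l.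
Qed.

Lemma nrmD f g : L2 mu f -> L2 mu g ->
  nrm (fun x => f x + g x) <= nrm f + nrm g.
Proof.
move=> Lf Lg; rewrite -(@ler_pXn2r R 2) ?nnegrE ?addr_ge0 ?nrm_ge0//.
rewrite sqr_nrmD// sqrrD -[(_ * _) *+ 2]mulr_natl lerD2r lerD2l ler_pM2l//.
exact: Re_ip_le.
Qed.

Lemma nrm_distC f g : nrm (fun x => f x - g x) = nrm (fun x => g x - f x).
Proof. by apply: eq_nrm => x; rewrite normc_distC. Qed.

Lemma nrm_tri f g h : L2 mu f -> L2 mu g -> L2 mu h ->
  nrm (fun x => f x - h x) <= nrm (fun x => f x - g x) + nrm (fun x => g x - h x).
Proof.
move=> Lf Lg Lh; have := nrmD (L2B Lf Lg) (L2B Lg Lh).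
by under eq_fun do rewrite subrKA.
Qed.

Lemma nrm_sub f g : L2 mu f -> L2 mu g ->
  `|nrm f - nrm g| <= nrm (fun x => f x - g x).
Proof.
move=> Lf Lg; rewrite ler_norml lerBrDr lerBlDr.
have H h k : L2 mu h -> L2 mu k -> nrm h <= nrm (fun x => h x - k x) + nrm k.
  move=> Lh Lk; have := nrmD (L2B Lh Lk) Lk.
  by under eq_fun do rewrite subrK.
by rewrite [- _ + _]addrC lerBlDr addrC {1}nrm_distC !H.
Qed.

Lemma le_nrm f g (C : R) : cmeasurable f -> 0 <= C ->
    (forall x, normc (f x) <= C * normc (g x)) -> L2 mu g ->
  nrm f <= C * nrm g.
Proof.
move=> mf C0 fg Lg; have Lf := L2_bounded mf C0 fg Lg.
rewrite -(@ler_pXn2r R 2) ?nnegrE ?mulr_ge0 ?nrm_ge0//.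
have [mg _] := Lg; have := le_sqnorm mf mg C0 fg.
by rewrite exprMn !sqnormE// -EFinM lee_fin.
Qed.

Lemma nrm0 : nrm (fun _ => 0) = 0.
Proof. by have := nrmZ 0 L20; rewrite normc0 !mul0r. Qed.

(** Scalar products are thus determined by norms of combinations, so a linear correspondence that
    preserves norms preserves scalar products. *)
Lemma ip_polar f g : L2 mu f -> L2 mu g ->
  ip mu f g = 4^-1 * \sum_(n < 4) (- 'i) ^+ n *
    (nrm (fun x => f x + 'i ^+ n * g x) ^+ 2)%:C.
Proof.
move=> Lf Lg.
rewrite -[LHS](sum_polar (ip mu f f) _ (ip mu g f) (ip mu g g)).
congr (_ * _); apply: eq_bigr => n _; congr (_ * _).
have LZ := L2Z ('i ^+ n) Lg.
rewrite -ipff ipDr//; last exact: L2D.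
by rewrite ipZr ?ipDl ?ipZl//; [ring|exact: L2D].
Qed.

End L2Theory.

(** * Truncation in L^2 *)

Section Truncation.
Context d (T : measurableType d) (R : realType) (mu : {measure set T -> \bar R}).

(** Dominated convergence: the square modulus of f outside [A n] is at most |f|^2 and vanishes at
    each point from some n on. It serves for bounded truncations on the circle and for finite
    windows of integers. *)
Lemma nrm_truncation (A : nat -> set T) (f : T -> R[i]) (e : R) :
    L2 mu f -> (forall n, measurable (A n)) ->
    (forall x, exists N, forall n, (N <= n)%N -> A n x) -> 0 < e ->
  exists n, nrm mu (fun x => f x - (\1_(A n) x : R)%:C * f x) < e.
Proof.
move=> Lf mA Ax e0.
pose F n x := f x - (\1_(A n) x : R)%:C * f x.
have mF n : cmeasurable (F n).
  have : cmeasurable (fun x => f x + -1 * ((\1_(A n) x : R)%:C * f x)).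
    apply: cmeasurableD; first by case: Lf.
    apply: cmeasurableZ; apply: cmeasurableM; last by case: Lf.
    exact: cmeasurable_indic.
  by under eq_fun do rewrite mulN1r.
have FE n x : F n x = (\1_(~` A n) x : R)%:C * f x.
  rewrite /F !indicE in_setC.
  by case: (x \in A n) => /=; rewrite ?mul1r ?mul0r ?subrr ?subr0.
have F_le n x : normc (F n x) <= 1 * normc (f x).
  rewrite FE normcM normcC ler_wpM2r ?normc_ge0// indicE.
  by case: (_ \in _); rewrite ?normr1 ?normr0.
have LF n : L2 mu (F n) by apply: (L2_bounded (mF n) ler01 (F_le n)).
have ig : mu.-integrable setT (fun x => (normc (f x) ^+ 2)%:E).
  apply: (integrable_L2M Lf Lf); first by apply: measurable_normc_sqr; case: Lf.
  by move=> x; rewrite ger0_norm ?sqr_ge0// expr2.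
have mF2 n : measurable_fun setT (fun x => (normc (F n x) ^+ 2)%:E).
  exact/measurable_EFinP/measurable_normc_sqr.
have Fcvg x : (fun n => (normc (F n x) ^+ 2)%:E) @ \oo --> 0%E.
  have [N AN] := Ax x; apply: cvg_near_cst; exists N => // n /= /AN Anx.
  by rewrite FE indicE memNset ?mul0r ?normc0 ?expr0n//= => nA; apply: nA.
have Fdom x n : (`|(normc (F n x) ^+ 2)%:E| <= (normc (f x) ^+ 2)%:E)%E.
  rewrite abse_EFin lee_fin ger0_norm ?sqr_ge0//.
  by rewrite lerXn2r ?nnegrE ?normc_ge0// -[leRHS]mul1r.
have [_ _] := @dominated_convergence _ T R mu setT measurableT
  (fun n x => (normc (F n x) ^+ 2)%:E) (cst 0%E)
  (fun x => (normc (f x) ^+ 2)%:E) mF2 (measurable_cst _)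
  (aeW mu (fun x _ => Fcvg x)) ig (aeW mu (fun x n _ => Fdom x n)).
rewrite integral0 => /fine_cvg H.
have e2 : 0 < e ^+ 2 by rewrite exprn_gt0.
have [N _ /(_ N (leqnn _))] := cvgr_lt _ H _ e2.
rewrite /= -[fine _]/(fine (sqnorm mu (F N))) -sqr_nrm => HN; exists N.
by rewrite -(@ltr_pXn2r R 2) ?nnegrE ?nrm_ge0 ?(ltW e0).
Qed.

End Truncation.

(** * Transfer between a bare set function and a measure *)

Section RawMeasure.
Import HBNNSimple.
Context d (T : measurableType d) (R : realType).
Context (nu : set T -> \bar R) (mu : {measure set T -> \bar R}).
Context (nuE : forall A, measurable A -> nu A = mu A).

(** Integrals are suprema over simple functions, and a simple function involves only the values on
    its level sets, which are measurable. *)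
Lemma raw_integralE (f : T -> \bar R) :
  (\int[nu]_x f x = \int[mu]_x f x)%E.
Proof.
have sE (h : {nnsfun T >-> R}) : sintegral nu h = sintegral mu h.
  apply: eq_fsbigr => r _; congr (_ * _)%E; apply: nuE.
  exact: measurable_funPTI.
rewrite /integral.
congr (ereal_sup _ - ereal_sup _)%E; apply/seteqP; split => _ [h hf <-];
  by exists h => //; rewrite sE.
Qed.

Lemma raw_cintegralE f : cintegral nu f = cintegral mu f.
Proof. by rewrite /cintegral !raw_integralE. Qed.

Lemma raw_sqnormE f : sqnorm nu f = sqnorm mu f.
Proof. exact: raw_integralE. Qed.

Lemma raw_L2E f : L2 nu f = L2 mu f.
Proof. by rewrite /L2 raw_sqnormE. Qed.

Lemma raw_ipE f g : ip nu f g = ip mu f g.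
Proof. exact: raw_cintegralE. Qed.

End RawMeasure.

(** * Sequences: l^2 of the integers and its subspaces l^2(J) *)

Section Sequences.
Context (R : realType).
Implicit Types (J : set int) (v w : int -> R[i]) (j k : int).
Let cnt : {measure set int -> \bar R} := @counting int R.

Lemma cmeasurable_int v : cmeasurable v.
Proof. by split. Qed.

Lemma counting1 k : cnt [set k] = 1%E.
Proof. by rewrite /cnt /= /counting asboolT// fset_set1 finmap.cardfs1. Qed.

Lemma Rintegral_supp1 (g : int -> R) k :
  (forall x, x != k -> g x = 0) -> (\int[cnt]_x (g x)%:E)%E = (g k)%:E.
Proof.
move=> g0; rewrite (_ : (fun x => _) = (fun x => (g x)%:E) \_ [set k]); last first.
  apply/funext => x; rewrite patchE; case: ifPn => // /negP.
  by rewrite in_setE /= => /eqP /g0 ->.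
rewrite -integral_mkcond (eq_integral (cst (g k)%:E)); last first.
  by move=> x; rewrite inE /= => ->.
by rewrite integral_cst//= counting1 mule1.
Qed.

Lemma L2_delta k : L2 cnt (delta R k).
Proof.
split; first exact: cmeasurable_int.
rewrite /sqnorm (@Rintegral_supp1 _ k) ?ltry// => x /negPf xk.
by rewrite /delta xk normc0 expr0n.
Qed.

Lemma ip_deltal k v : ip cnt (delta R k) v = v k.
Proof.
rewrite /ip /cintegral !(@Rintegral_supp1 _ k)/=.
- by rewrite /delta eqxx rmorph1 mul1r; case: (v k).
- by move=> x /negPf xk; rewrite /delta xk rmorph0 mul0r.
- by move=> x /negPf xk; rewrite /delta xk rmorph0 mul0r.
Qed.

Lemma nrm_delta k : nrm cnt (delta R k) = 1.
Proof.
have := ip_deltal k (delta R k); rewrite ipff /delta eqxx => /complexI /eqP.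
by rewrite sqrf_eq1 => /orP[/eqP //|/eqP n1]; have := nrm_ge0 cnt (delta R k);
  rewrite /delta n1 lerNr oppr0 ler10.
Qed.

Lemma l2D J v w : l2 J v -> l2 J w -> l2 J (fun k => v k + w k).
Proof.
move=> [v2 v0] [w2 w0]; split; first exact: L2D.
by move=> k Jk; rewrite v0// w0// addr0.
Qed.

Lemma l2Z J (a : R[i]) v : l2 J v -> l2 J (fun k => a * v k).
Proof.
by move=> [v2 v0]; split=> [|k Jk]; [exact: L2Z|rewrite v0// mulr0].
Qed.

Lemma l2B J v w : l2 J v -> l2 J w -> l2 J (fun k => v k - w k).
Proof.
move=> lv lw; have := l2D lv (l2Z (-1) lw).
by under eq_fun do rewrite mulN1r.
Qed.

Lemma l20 J : l2 J (fun _ => 0 : R[i]).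
Proof. by split => //; exact: L20. Qed.

Lemma l2_delta J k : J k -> l2 J (delta R k).
Proof.
move=> Jk; split=> [|j Jj]; first exact: L2_delta.
by rewrite /delta; case: eqP => // jk; case: Jj; rewrite jk.
Qed.

Lemma l2_sum (I : eqType) J (s : seq I) (F : I -> int -> R[i]) :
  (forall i, i \in s -> l2 J (F i)) -> l2 J (fun x => \sum_(i <- s) F i x).
Proof.
move=> lF; split; first by apply: L2_sum => i /lF [].
by move=> k Jk; rewrite big_seq big1// => i /lF [_ ->].
Qed.

Lemma l2_dense J v (e : R) : l2 J v -> 0 < e ->
  exists s : seq int, (forall k, k \in s -> J k) /\
    nrm cnt (fun x => v x - \sum_(k <- s) v k * delta R k x) < e.
Proof.
move=> [Lv v0] e0.
(* The list [r n] runs through the integers from -n to n; every integer belongs to it from some n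
   on. *)
pose r n := [seq (m%:Z - n%:Z) | m <- iota 0 n.*2.+1].
have rP n x : (x \in r n) = (`|x| <= n%:Z).
  apply/mapP/idP => [[m]|].
    rewrite mem_iota add0n ltnS -addnn => /andP[_ mn ->].
    by rewrite ler_norml lerBrDr addNr lerBlDr -PoszD !lez_nat leq0n.
  rewrite ler_norml => /andP[nx xn].
  have : 0 <= x + n%:Z by rewrite -lerBlDr sub0r.
  case E : (x + n%:Z) => [m|//] _; exists m; last by rewrite -E addrK.
  by rewrite mem_iota add0n ltnS leq0n -addnn -lez_nat PoszD -E lerD2r.
have [n|x|n Hn] := nrm_truncation (A := fun n => [set x | x \in r n]) Lv _ _ e0.
- by [].
- by exists `|x|%N => n; rewrite /= rP -abszE lez_nat.
(* Discarding the indices outside J changes nothing, because v vanishes there. *)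
exists [seq k <- r n | `[< J k >]]; split.
  by move=> k; rewrite mem_filter => /andP[/asboolP].
rewrite (@eq_nrm _ _ _ _ _ (fun x => v x - (\1_[set x | x \in r n] x : R)%:C * v x))//.
move=> x; congr (normc (_ - _)).
have ur : uniq [seq k <- r n | `[< J k >]].
  rewrite filter_uniq// map_inj_uniq ?iota_uniq// => a b /addIr; by case.
have xE k : k != x -> v k * delta R k x = 0.
  by move=> kx; rewrite /delta eq_sym (negPf kx) mulr0.
have [xs|xs] := boolP (x \in [seq k <- r n | `[< J k >]]).
  rewrite (bigD1_seq x)//= big1 ?addr0; last by move=> k; exact: xE.
  move: xs; rewrite mem_filter => /andP[_ xr].
  by rewrite indicE mem_set// mul1r /delta eqxx mulr1.
rewrite big_seq big1; last first.
  by move=> k ks; apply: xE; apply: contraNneq xs => <-.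
move: xs; rewrite mem_filter negb_and => /orP[/asboolPn Jx|xr].
  by rewrite v0// mulr0.
by rewrite indicE memNset ?mul0r//=; exact/negP.
Qed.

End Sequences.

(** * The scalar measures attached to a spectral measure *)

Section Spectral.
Context (R : realType) (J : set int) (U : operator R).
Context (E : set (circle_borel R) -> operator R).
Context (HE : spectral_measure J U E).
Implicit Types (f g v w : int -> R[i]) (A B : set (circle_borel R)).
Implicit Types (h : circle_borel R -> R[i]) (S : operator R) (a : R[i]).
Let cnt : {measure set int -> \bar R} := @counting int R.

Let l2E A f : measurable A -> l2 J f -> l2 J (E A f).
Proof. by move=> mA; exact: (spectral_stable HE mA). Qed.

Lemma l2ip_spectral A B f : measurable A -> measurable B -> l2 J f ->
  l2ip (E A f) (E B f) = l2ip f (E (A `&` B) f).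
Proof.
move=> mA mB lf; rewrite (spectral_setI HE mA mB lf).
by rewrite (spectral_selfadjoint HE mA lf (l2E mB lf)).
Qed.

Lemma l2ip_spectral_diag A f : measurable A -> l2 J f ->
  l2ip f (E A f) = (nrm cnt (E A f) ^+ 2)%:C.
Proof.
by move=> mA lf; rewrite -ipff; have := l2ip_spectral mA mA lf; rewrite setIid => <-.
Qed.

(** Sigma-additivity is applied to the family all of whose members are empty: the remainder after n
    terms is (1 - n) E(set0) f, and it must tend to 0. *)
Lemma nrm_spectral_set0 f : l2 J f -> nrm cnt (E set0 f) = 0.
Proof.
move=> lf; have l0 := l2E measurable0 lf.
have := @spectral_sigma_additive _ _ _ _ HE (fun=> set0) (fun=> measurable0).
have t0 : trivIset [set: nat] (fun=> set0 : set (circle_borel R)).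
  by move=> i j _ _ [x []].
move=> /(_ t0 _ lf).
rewrite bigcup0// => /fine_cvg H.
apply/eqP; rewrite -sqrf_eq0 sqr_nrm -[_ == _]/(_ == 0 :> R).
rewrite eq_le fine_ge0 ?sqnorm_ge0// andbT; apply/ler_addgt0Pr => e e0.
(* With n = N + 2 the factor 1 - n has modulus N + 1 >= 1, so the remainder is at least as large as
   E(set0) f. *)
have [N _ /(_ N.+2 (leq_trans (leqnSn _) (leqnSn _)))] := cvgr_lt _ H _ e0.
rewrite add0r /= => /ltW; apply: le_trans.
rewrite -!sqr_nrm lerXn2r ?nnegrE ?nrm_ge0//.
rewrite (@eq_nrm _ _ _ _ (fun k => _ - _) (fun k => - N.+1%:R * E set0 f k)).
  rewrite nrmZ; last by case: l0.
  rewrite normcN -[_%:R](rmorph_nat (real_complex R)) normcC ler_peMl ?nrm_ge0//.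
  by rewrite ger0_norm// ler1n.
move=> k; rewrite sumr_const card_ord mulNr mulr_natl mulrS.
by rewrite opprD addNKr.
Qed.

(** The measure is taken to be the square norm of E(A) f, which is nonnegative for every set A, as a
    measure structure demands; it equals (f, E(A) f) for measurable A. Cauchy-Schwarz turns norm
    convergence of the partial sums into countable additivity. *)
Lemma spectral_scalar f : l2 J f ->
  exists mu : {measure set (circle_borel R) -> \bar R},
    forall A, measurable A -> diagonal_measure E f A = mu A.
Proof.
move=> lf; pose m A : \bar R := (nrm cnt (E A f) ^+ 2)%:E.
have m0 : m set0 = 0%E by rewrite /m nrm_spectral_set0// expr0n.
have m_ge0 A : (0 <= m A)%E by rewrite lee_fin sqr_ge0.
have mE A : measurable A -> nrm cnt (E A f) ^+ 2 = complex.Re (l2ip f (E A f)).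
  by move=> mA; rewrite l2ip_spectral_diag.
have m_sigma : semi_sigma_additive m.
  move=> F mF tF mUF.
  have /fine_cvg H := spectral_sigma_additive HE mF tF lf.
  have {}H : (fun n => nrm cnt (fun k => E (\bigcup_m F m) f k -
      \sum_(m < n) E (F m) f k)) @ \oo --> 0.
    by rewrite -sqrtr0; apply: continuous_cvg H; exact: sqrt_continuous.
  rewrite (_ : (fun n => _) =
    EFin \o (fun n => \sum_(m < n) nrm cnt (E (F m) f) ^+ 2)); last first.
    by apply/funext => n /=; rewrite big_mkord sumEFin.
  apply: cvg_EFin; first exact: nearW.
  rewrite /comp /=; apply/cvgrPdist_le => e e0.
  (* The added 1 keeps the quotient defined when f has norm 0. *)
  have C0 : 0 < e / (nrm cnt f + 1).
    by rewrite divr_gt0// ltr_wpDl ?nrm_ge0.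
  have lS n : l2 J (fun k => \sum_(m < n) E (F m) f k).
    by apply: l2_sum => i _; exact: l2E.
  have ipS n : complex.Re (ip cnt f (fun k => \sum_(m < n) E (F m) f k)) =
      \sum_(m < n) nrm cnt (E (F m) f) ^+ 2.
    elim: n => [|n IH].
      rewrite big_ord0; under eq_fun do rewrite big_ord0.
      have := ipZr 0 lf.1 (L20 cnt); rewrite !mul0r.
      by move=> ->.
    rewrite big_ord_recr -IH mE//=.
    transitivity (complex.Re (ip cnt f (fun k =>
        \sum_(m < n) E (F m) f k + E (F n) f k))).
      by congr (complex.Re (ip cnt f _)); apply/funext => k; rewrite big_ord_recr.
    by have -> := ipDr (mu := cnt) lf.1 (lS n).1 (l2E (mF n) lf).1; rewrite ReD.
  apply: filterS (cvgr_lt _ H _ C0) => n Hn.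
  rewrite -ipS mE// -[l2ip _ _]/(ip cnt _ _).
  move: (lS n); set u := E _ f; set w := (fun k => \sum_(m < n) E (F m) f k).
  move=> {}lS; have lu : l2 J u by exact: l2E.
  have -> : complex.Re (ip cnt f u) - complex.Re (ip cnt f w) =
      complex.Re (ip cnt f (fun k => u k + -1 * w k)).
    have -> := ipDr (mu := cnt) lf.1 lu.1 (L2Z (mu := cnt) (-1) lS.1).
    have -> := ipZr (mu := cnt) (-1) lf.1 lS.1.
    by rewrite ReD mulN1r; case: (ip cnt f w).
  apply: le_trans (normc_Re _) _.
  apply: le_trans (normc_ip_le lf.1 (L2D lu.1 (L2Z (-1) lS.1))) _.
  have -> : nrm cnt (fun k => u k + -1 * w k) = nrm cnt (fun k => u k - w k).
    by apply: eq_nrm => k; rewrite mulN1r.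
  apply: (@le_trans _ _ ((nrm cnt f + 1) * (e / (nrm cnt f + 1)))).
    apply: ler_pM; rewrite ?nrm_ge0 ?lerDl//; exact: ltW.
  by rewrite mulrC divfK// gt_eqF// ltr_wpDl ?nrm_ge0.
pose M := isMeasure.Build _ _ _ m m0 m_ge0 m_sigma.
pose mu : {measure set (circle_borel R) -> \bar R} := HB.pack m M.
by exists mu => A mA; rewrite /diagonal_measure -mE.
Qed.

End Spectral.

(** * Functional calculus for simple functions *)

Section Calculus.
Context (R : realType) (J : set int) (U : operator R).
Context (E : set (circle_borel R) -> operator R).
Context (HE : spectral_measure J U E).
Implicit Types (f g v w : int -> R[i]) (A B : set (circle_borel R)).
Implicit Types (h : circle_borel R -> R[i]) (S : operator R) (a : R[i]).
Let cnt : {measure set int -> \bar R} := @counting int R.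

(* h is a simple function and S is the integral of h with respect to E. *)
Inductive calculus : (circle_borel R -> R[i]) -> operator R -> Prop :=
| calculus0 : calculus (fun _ => 0) (fun _ _ => 0)
| calculus_cons a A h S : measurable A -> calculus h S ->
    calculus (fun x => a * (\1_A x : R)%:C + h x)
             (fun f k => a * E A f k + S f k).

Lemma calculusD h S h' S' : calculus h S -> calculus h' S' ->
  calculus (fun x => h x + h' x) (fun f k => S f k + S' f k).
Proof.
move=> c c'; elim: c => {h S} [|a A h S mA _ IH].
  rewrite (_ : (fun x => _) = h'); last by apply/funext => x; rewrite add0r.
  by rewrite (_ : (fun f => _) = S')//; apply/funext => f; apply/funext => k;
    rewrite add0r.
have := calculus_cons a mA IH; congr calculus; do ?[apply/funext => ?];
  by rewrite addrA.
Qed.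

Lemma calculusZ a h S : calculus h S ->
  calculus (fun x => a * h x) (fun f k => a * S f k).
Proof.
elim=> {h S} [|b A h S mA _ IH].
  by have := calculus0; congr calculus; do ?[apply/funext => ?]; rewrite mulr0.
have := calculus_cons (a * b) mA IH; congr calculus; do ?[apply/funext => ?];
  by rewrite mulrDr mulrA.
Qed.

Lemma calculus_indic A : measurable A -> calculus (fun x => (\1_A x : R)%:C) (E A).
Proof.
move=> mA; have := calculus_cons 1 mA calculus0.
by congr calculus; do ?[apply/funext => ?]; rewrite mul1r addr0.
Qed.

Lemma calculus_cmeasurable h S : calculus h S -> cmeasurable h.
Proof.
elim=> {h S} [|a A h S mA _ IH]; first exact: cmeasurable_cst.
apply: cmeasurableD => //; apply: cmeasurableZ; exact: cmeasurable_indic.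
Qed.

Lemma calculus_l2 h S : calculus h S -> forall f, l2 J f -> l2 J (S f).
Proof.
elim=> {h S} [|a A h S mA _ IH] f lf; first exact: l20.
by apply: l2D; [apply: l2Z; exact: (spectral_stable HE mA)|exact: IH].
Qed.

Lemma calculus_linear h S : calculus h S -> forall a f g, l2 J f -> l2 J g ->
  S (fun k => a * f k + g k) = (fun k => a * S f k + S g k).
Proof.
elim=> {h S} [|b A h S mA _ IH] a f g lf lg.
  by apply/funext => k; rewrite mulr0 addr0.
by rewrite (spectral_linear HE mA)// IH//; apply/funext => k; ring.
Qed.

Lemma calculusB h S : calculus h S -> forall f g, l2 J f -> l2 J g ->
  S (fun k => f k - g k) = (fun k => S f k - S g k).
Proof.
move=> c f g lf lg; rewrite (_ : (fun k => f k - g k) = fun k => -1 * g k + f k).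
  by rewrite (calculus_linear c)//; apply/funext => k; ring.
by apply/funext => k; ring.
Qed.

(** Multiplicativity comes from E(A [&] B) = E(A) E(B), which holds on l^2(J) only; so the product
    has an integral S'' that agrees with the composite there. *)
Lemma calculusM h S h' S' : calculus h S -> calculus h' S' ->
  exists S'', calculus (fun x => h x * h' x) S'' /\
    forall f, l2 J f -> S'' f = S (S' f).
Proof.
move=> c c'; elim: c => {h S} [|a A h S mA _ [T [cT TE]]].
  exists (fun _ _ => 0); split=> //; have := calculus0; congr calculus.
  by apply/funext => x; rewrite mul0r.
have [V [cV VE]] : exists V, calculus (fun x => (\1_A x : R)%:C * h' x) V /\
    forall f, l2 J f -> V f = E A (S' f).
  elim: c' => {T cT TE h h' S S'} [|b B h S mB cS [T [cT TE]]].
    exists (fun _ _ => 0); split=> [|f lf].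
      by have := calculus0; congr calculus; apply/funext => x; rewrite mulr0.
    have := spectral_linear HE mA 0 (l20 R J) (l20 R J).
    rewrite !mul0r !addr0 => EA0.
    (* Linearity with the scalar -1 at the zero sequence reads E(A) 0 = - E(A) 0 + E(A) 0, hence
       E(A) 0 = 0. *)
    have := spectral_linear HE mA (-1) (l20 R J) (l20 R J).
    rewrite mulr0 addr0 => ->; apply/funext => k; ring.
  exists (fun f k => b * E (A `&` B) f k + T f k); split => [|f lf].
    have := calculus_cons b (measurableI _ _ mA mB) cT; congr calculus.
    apply/funext => x; rewrite indicI /= rmorphM /=; ring.
  rewrite TE// (spectral_setI HE mA mB lf) -(spectral_linear HE mA)//.
    exact: (spectral_stable HE mB).
  exact: (calculus_l2 cS).
exists (fun f k => a * V f k + T f k); split => [|f lf].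
  have := calculusD (calculusZ a cV) cT; congr calculus.
  by apply/funext => x; ring.
by rewrite VE// TE.
Qed.

(** Each E(A) is self-adjoint, so conjugating the coefficients gives the adjoint. *)
Lemma calculusJ h S : calculus h S ->
  exists S', calculus (fun x => (h x)^*) S' /\
    forall f g, l2 J f -> l2 J g -> l2ip (S f) g = l2ip f (S' g).
Proof.
elim=> {h S} [|a A h S mA cS [S' [cS' adj]]].
  exists (fun _ _ => 0); split=> [|f g lf lg].
    by have := calculus0; congr calculus; apply/funext => x; rewrite rmorph0.
  have := ipZl (mu := cnt) 0 lg.1 (L20 cnt); rewrite rmorph0 !mul0r.
  have := ipZr (mu := cnt) 0 lf.1 (L20 cnt); rewrite !mul0r.
  by rewrite /l2ip => -> ->.
exists (fun f k => a^* * E A f k + S' f k); split => [|f g lf lg].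
  have := calculus_cons (a^*) mA cS'; congr calculus; apply/funext => x.
  rewrite rmorphD rmorphM /=; congr (_ * _ + _); apply/esym.
  by apply/eqP; rewrite eq_complex /= oppr0 !eqxx.
have lE u : l2 J u -> l2 J (E A u) by exact: (spectral_stable HE mA).
have lS := calculus_l2 cS; have lS' := calculus_l2 cS'.
have H1 := ipDl (mu := cnt) lg.1 (L2Z (mu := cnt) a (lE _ lf).1) (lS _ lf).1.
have H2 := ipDr (mu := cnt) lf.1 (L2Z (mu := cnt) (a^*) (lE _ lg).1) (lS' _ lg).1.
rewrite /l2ip; rewrite [LHS]H1 [RHS]H2.
have -> := ipZl (mu := cnt) a lg.1 (lE _ lf).1.
have -> := ipZr (mu := cnt) (a^*) lf.1 (lE _ lg).1.
congr (_ * _ + _); last exact: adj.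
by have := spectral_selfadjoint HE mA lf lg => /esym.
Qed.

Lemma calculus_bounded h S : calculus h S ->
  exists2 C : R, 0 <= C & forall x, normc (h x) <= C.
Proof.
elim=> {h S} [|a A h S mA _ [C C0 hC]]; first by exists 0 => // x; rewrite normc0.
exists (normc a + C) => [|x]; first by rewrite addr_ge0// normc_ge0.
rewrite (le_trans (normcD _ _))// lerD// normcM normcC ler_piMr ?normc_ge0//.
by rewrite indicE; case: (_ \in _); rewrite ?normr1 ?normr0.
Qed.

Section ScalarMeasure.
Context f (lf : l2 J f) (mu : {measure set (circle_borel R) -> \bar R}).
Context (muE : forall A, measurable A -> diagonal_measure E f A = mu A).

Lemma scalarE A : measurable A -> mu A = (nrm cnt (E A f) ^+ 2)%:E.
Proof.
by move=> mA; rewrite -muE// /diagonal_measure (l2ip_spectral_diag HE).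
Qed.

Lemma scalarT : mu setT = (nrm cnt f ^+ 2)%:E.
Proof. by rewrite scalarE// (spectral_setT HE). Qed.

Lemma bounded_cintegrable h (C : R) : cmeasurable h ->
  (forall x, normc (h x) <= C) -> cintegrable mu h.
Proof.
move=> [m1 m2] hC; have iC : mu.-integrable setT (EFin \o cst C).
  apply/integrableP; split.
    by apply/measurable_EFinP; exact: measurable_cst.
  by rewrite /comp /= integral_cst// scalarT -EFinM ltry.
have b (k : circle_borel R -> R) : measurable_fun setT k ->
    (forall x, `|k x| <= C) -> mu.-integrable setT (fun x => (k x)%:E).
  move=> mk kC; apply: le_integrable iC => //; first exact/measurable_EFinP.
  by move=> x _; rewrite lee_fin (le_trans (kC x))// ler_norm.
by split; apply: b => // x; [apply: le_trans (hC x); exact: normc_Re|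
  apply: le_trans (hC x); exact: normc_Im].
Qed.

Lemma calculus_cintegrable h S : calculus h S -> cintegrable mu h.
Proof.
move=> c; have [C _ hC] := calculus_bounded c.
by apply: bounded_cintegrable hC; exact: calculus_cmeasurable c.
Qed.

Lemma cintegral_calculus h S : calculus h S -> cintegral mu h = l2ip f (S f).
Proof.
elim=> {h S} [|a A h S mA c IH].
  have := cintegralZ 0 (calculus_cintegrable calculus0); rewrite !mul0r => ->.
  by have := ipZr (mu := cnt) 0 lf.1 (L20 cnt); rewrite !mul0r => /esym.
have cA := calculus_cintegrable (calculus_indic mA).
rewrite cintegralD; [|exact: cintegrableZ|exact: calculus_cintegrable c].
rewrite cintegralZ// IH /l2ip.
have lE := spectral_stable HE mA lf.
have -> := ipDr (mu := cnt) lf.1 (L2Z (mu := cnt) a lE.1) (calculus_l2 c lf).1.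
have -> := ipZr (mu := cnt) a lf.1 lE.1.
congr (_ * _ + _); have := l2ip_spectral_diag HE mA lf; rewrite /l2ip => ->.
rewrite /cintegral /= integral0; congr (_ +i* _).
by rewrite integral_indic// setIT scalarE.
Qed.

(** The integral of conj(h) h' is (f, V S' f), with V the adjoint of S. *)
Lemma ip_calculus h S h' S' : calculus h S -> calculus h' S' ->
  ip mu h h' = l2ip (S f) (S' f).
Proof.
move=> c c'; have [V [cV adj]] := calculusJ c.
have [V' [cV' V'E]] := calculusM cV c'.
rewrite adj//; last exact: (calculus_l2 c').
by rewrite -V'E// -(cintegral_calculus cV').
Qed.

Lemma bounded_L2 h (C : R) : cmeasurable h -> 0 <= C ->
  (forall x, normc (h x) <= C) -> L2 mu h.
Proof.
move=> mh C0 hC; have L1 : L2 mu (fun _ => 1).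
  split; first exact: cmeasurable_cst.
  rewrite /sqnorm; under eq_integral do rewrite normc1 expr1n.
  by rewrite integral_cst// mul1e scalarT ltry.
by apply: (L2_bounded mh C0 _ L1) => x; rewrite normc1 mulr1.
Qed.

Lemma calculus_L2 h S : calculus h S -> L2 mu h.
Proof.
move=> c; have [C C0 hC] := calculus_bounded c.
by apply: bounded_L2 hC => //; exact: calculus_cmeasurable c.
Qed.

Lemma nrm_calculus h S : calculus h S -> nrm mu h = nrm cnt (S f).
Proof.
move=> c; apply/eqP; rewrite -(@eqrXn2 _ 2) ?nrm_ge0//; apply/eqP.
by apply: complexI; rewrite -!ipff (ip_calculus c c).
Qed.

Lemma nrm_bounded h (C : R) : cmeasurable h -> 0 <= C ->
  (forall x, normc (h x) <= C) -> nrm mu h <= C * nrm cnt f.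
Proof.
move=> mh C0 hC.
have n1 : nrm mu (fun _ => 1) = nrm cnt f.
  have := nrm_calculus (calculus_indic measurableT).
  rewrite (spectral_setT HE)// => <-; apply: eq_nrm => x.
  by rewrite indicT.
rewrite -n1; apply: le_nrm => //; first by move=> x; rewrite normc1 mulr1.
by apply: (bounded_L2 (cmeasurable_cst _ 1) ler01) => x; rewrite normc1.
Qed.

End ScalarMeasure.

(** The operator bound by the supremum of |h| is read off in L^2 of the measure belonging to f
    itself, whose total mass is the square norm of f. *)
Lemma nrm_calculus_le h S (C : R) f : calculus h S -> 0 <= C ->
  (forall x, normc (h x) <= C) -> l2 J f -> nrm cnt (S f) <= C * nrm cnt f.
Proof.
move=> c C0 hC lf; have [mu muE] := spectral_scalar HE lf.
rewrite -(nrm_calculus lf muE c); apply: (nrm_bounded lf muE) => //.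
exact: calculus_cmeasurable c.
Qed.

End Calculus.

(** * Approximation by simple functions, and the isometry as a relation *)

Section Approximation.
Context (R : realType) (J : set int) (U : operator R).
Context (E : set (circle_borel R) -> operator R).
Context (HE : spectral_measure J U E).
Implicit Types (f g u v w : int -> R[i]) (A B : set (circle_borel R)).
Implicit Types (h b s z : circle_borel R -> R[i]) (S Z : operator R) (a : R[i]).
Let cnt : {measure set int -> \bar R} := @counting int R.

Lemma exists_div_expr2_le (L e : R) : 0 <= L -> 0 < e -> exists n, L / 2 ^+ n <= e.
Proof.
move=> L0 e0; pose n := (Num.truncn (L / e)).+1; exists n.
rewrite ler_pdivrMr ?exprn_gt0// mulrC -ler_pdivrMr//.
apply: (@le_trans _ _ n%:R); first by apply: ltW; exact: truncnS_gt.
by rewrite -natrX ler_nat ltnW// ltn_expl.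
Qed.

(** A binary expansion of k: where the remainder k - r is at least half of its current bound, that
    half is added to r. The remainder stays nonnegative and its bound is halved. *)
Lemma calculus_uniform_real (k : circle_borel R -> R) (L : R) :
    measurable_fun setT k -> 0 <= L -> (forall x, 0 <= k x <= L) ->
  forall n, exists (r : circle_borel R -> R) S,
    [/\ calculus E (fun x => (r x)%:C) S, measurable_fun setT r &
        forall x, 0 <= k x - r x <= L / 2 ^+ n].
Proof.
move=> mk L0 kL; elim=> [|n [r [S [cS mr kr]]]].
  exists (fun=> 0), (fun _ _ => 0); split.
  - exact: calculus0.
  - exact: measurable_cst.
  - by move=> x; rewrite subr0 expr0 divr1.
set t := L / 2 ^+ n.+1.
have tE : L / 2 ^+ n = t + t by rewrite /t exprS; field; rewrite expf_neq0.
pose A : set (circle_borel R) := [set x | t <= k x - r x].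
have mA : measurable A.
  have -> : A = setT `&` (k \- r) @^-1` `[t, +oo[%classic.
    by rewrite setTI; apply/seteqP; split => x /=; rewrite in_itv /= andbT.
  by apply: (measurable_funB mk mr) => //; exact: measurable_itv.
exists (fun x => r x + t * \1_A x), (fun f j => t%:C * E A f j + S f j); split.
- have := calculus_cons t%:C mA cS; congr calculus; apply/funext => x.
  have CM (p q c : R) : q%:C * p%:C + c%:C = (c + q * p)%:C.
    by rewrite addrC rmorphD rmorphM.
  exact: CM.
- by apply: measurable_funD => //; apply: measurable_funM => //;
    exact: measurable_indic.
- move=> x; have := kr x; rewrite tE indicE => /andP[r1 r2].
  have [xA|xA] := boolP (x \in A).
    by move: xA; rewrite inE /A /= => xA; rewrite mulr1; apply/andP; split; lra.
  move: xA; rewrite notin_setE /A /= => /negP; rewrite -ltNge => xA.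
  by rewrite mulr0 addr0 r1 ltW.
Qed.

Lemma calculus_uniform h (C e : R) : cmeasurable h -> 0 <= C ->
    (forall x, normc (h x) <= C) -> 0 < e ->
  exists s S, calculus E s S /\ forall x, normc (h x - s x) <= e.
Proof.
move=> [m1 m2] C0 hC e0.
have e2 : 0 < e / 2 by rewrite divr_gt0.
have CC : 0 <= C + C by rewrite addr_ge0.
have [n nC] := exists_div_expr2_le CC e2.
have U1 (k : circle_borel R -> R) : measurable_fun setT k ->
    (forall x, `|k x| <= C) -> exists (r : circle_borel R -> R) S,
    calculus E (fun x => (r x)%:C) S /\ forall x, `|k x + C - r x| <= e / 2.
  move=> mk kC; have [||x|r [S [cS _ rk]]] := @calculus_uniform_real
      (fun x => k x + C) (C + C) _ _ _ n.
  - by apply: measurable_funD.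
  - by [].
  - by have := kC x; rewrite ler_norml => /andP[]; lra.
  - exists r, S; split=> // x; have /andP[r1 r2] := rk x.
    by rewrite ger0_norm// (le_trans r2).
have [r [S [cS rk]]] := U1 _ m1 (fun x => le_trans (normc_Re (h x)) (hC x)).
have [r' [S' [cS' rk']]] := U1 _ m2 (fun x => le_trans (normc_Im (h x)) (hC x)).
(* The real and imaginary parts were shifted by C to become nonnegative; a constant on the whole
   circle undoes both shifts. *)
have c1 := calculus_cons (- (C +i* C)) measurableT (calculusD cS (calculusZ 'i cS')).
eexists _, _; split; first exact: c1.
move=> x; rewrite indicT /= (le_trans (normc_le_ReIm _))// [leRHS]splitr.
have -> : h x - (- (C +i* C) * 1%:C + ((r x)%:C + 'i * (r' x)%:C)) =
  (complex.Re (h x) + C - r x) +i* (complex.Im (h x) + C - r' x).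
  by case: (h x) => p q; apply/eqP; rewrite eq_complex /=;
    apply/andP; split; apply/eqP; ring.
by rewrite lerD//=.
Qed.

Section Vector.
Context f0 (lf0 : l2 J f0) (mu : {measure set (circle_borel R) -> \bar R}).
Context (muE : forall A, measurable A -> diagonal_measure E f0 A = mu A).

(** Truncation to the set where |h| <= n makes the function bounded; a uniform error then costs at
    most itself times the norm of f0, since mu has finite mass. *)
Lemma calculus_dense h (e : R) : L2 mu h -> 0 < e ->
  exists s S, calculus E s S /\ nrm mu (fun x => h x - s x) < e.
Proof.
move=> Lh e0; have mh := Lh.1.
pose A n : set (circle_borel R) := [set x | normc (h x) <= n%:R].
have mA n : measurable (A n).
  have -> : A n = setT `&` (fun x => normc (h x)) @^-1` `]-oo, n%:R]%classic.
    by rewrite setTI; apply/seteqP; split => x /=; rewrite in_itv.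
  by apply: (measurable_normc mh) => //; exact: measurable_itv.
have e2 : 0 < e / 2 by rewrite divr_gt0.
have [|n Hn] := nrm_truncation Lh mA _ e2.
  move=> x; exists (Num.truncn (normc (h x))).+1 => n nx; rewrite /A /=.
  rewrite (@le_trans _ _ (Num.truncn (normc (h x))).+1%:R)// ?ler_nat//.
  by apply: ltW; exact: truncnS_gt.
pose hn x := (\1_(A n) x : R)%:C * h x.
have mhn : cmeasurable hn by apply: cmeasurableM => //; exact: cmeasurable_indic.
have hnC x : normc (hn x) <= n%:R.
  rewrite /hn normcM normcC indicE; have [|_] := boolP (x \in A n).
    by rewrite inE /A /= normr1 mul1r.
  by rewrite normr0 mul0r.
have N0 : 0 < nrm cnt f0 + 1 by rewrite ltr_wpDl ?nrm_ge0.
have e3 : 0 < e / 2 / (nrm cnt f0 + 1) by rewrite divr_gt0.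
have [s [S [cS hs]]] := calculus_uniform mhn (ler0n _ n) hnC e3.
exists s, S; split=> //.
have Ls := calculus_L2 HE lf0 muE cS.
have Lhn := bounded_L2 HE lf0 muE mhn (ler0n _ n) hnC.
rewrite (le_lt_trans (nrm_tri Lh Lhn Ls))// [ltRHS]splitr ltr_leD//.
have := nrm_bounded HE lf0 muE (L2B Lhn Ls).1 (ltW e3) hs.
move=> /le_trans; apply.
by rewrite mulrAC ler_pdivrMr// ler_wpM2l ?(ltW e2)// lerDl.
Qed.

(* [approx h v]: the isometry taking the class of the function 1 to f0 and
   intertwining multiplication by zeta with U takes h to v. *)
Definition approx h v := [/\ L2 mu h, l2 J v & forall e : R, 0 < e ->
  exists s S, [/\ calculus E s S, nrm mu (fun x => h x - s x) < e &
    nrm cnt (fun k => v k - S f0 k) < e]].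

Lemma approx_calculus s S : calculus E s S -> approx s (S f0).
Proof.
move=> c; split.
- exact: (calculus_L2 HE lf0 muE c).
- exact: (calculus_l2 HE c).
- move=> e e0; exists s, S; split => //.
    by under eq_fun do rewrite subrr; rewrite nrm0.
  by under eq_fun do rewrite subrr; rewrite nrm0.
Qed.

Lemma approx1 : approx (fun _ => 1) f0.
Proof.
have := approx_calculus (calculus_indic E measurableT).
rewrite (spectral_setT HE)//; congr approx; apply/funext => x.
by rewrite indicT.
Qed.

Lemma approxD h v h' v' : approx h v -> approx h' v' ->
  approx (fun x => h x + h' x) (fun k => v k + v' k).
Proof.
move=> [Lh lv H] [Lh' lv' H']; split; [exact: L2D|exact: l2D|] => e e0.
have e2 : 0 < e / 2 by rewrite divr_gt0.
have [s [S [cS hs vs]]] := H _ e2; have [s' [S' [cS' hs' vs']]] := H' _ e2.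
have Ls := calculus_L2 HE lf0 muE cS; have Ls' := calculus_L2 HE lf0 muE cS'.
have lS := calculus_l2 HE cS lf0; have lS' := calculus_l2 HE cS' lf0.
eexists _, _; split; first exact: (calculusD cS cS').
  have := nrmD (L2B Lh Ls) (L2B Lh' Ls').
  under eq_fun do rewrite addrACA -opprD.
  by move=> /le_lt_trans; apply; rewrite [ltRHS]splitr ltrD.
have := nrmD (L2B lv.1 lS.1) (L2B lv'.1 lS'.1).
under eq_fun do rewrite addrACA -opprD.
by move=> /le_lt_trans; apply; rewrite [ltRHS]splitr ltrD.
Qed.

Lemma approxZ a h v : approx h v -> approx (fun x => a * h x) (fun k => a * v k).
Proof.
move=> [Lh lv H]; split; [exact: L2Z|exact: l2Z|] => e e0.
have a0 : 0 < normc a + 1 by rewrite ltr_wpDl ?normc_ge0.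
have e2 : 0 < e / (normc a + 1) by rewrite divr_gt0.
have [s [S [cS hs vs]]] := H _ e2.
have Ls := calculus_L2 HE lf0 muE cS; have lS := calculus_l2 HE cS lf0.
have aux x : 0 <= x -> x < e / (normc a + 1) -> normc a * x < e.
  move=> x0; rewrite ltr_pdivlMr// mulrDr mulr1 => xe.
  by rewrite mulrC (le_lt_trans _ xe)// lerDl.
eexists _, _; split; first exact: (calculusZ a cS).
  have := nrmZ a (L2B Lh Ls); under eq_fun do rewrite mulrBr.
  by move=> ->; rewrite aux ?nrm_ge0.
have := nrmZ a (L2B lv.1 lS.1); under eq_fun do rewrite mulrBr.
by move=> ->; rewrite aux ?nrm_ge0.
Qed.

Lemma approx_nrm h v : approx h v -> nrm mu h = nrm cnt v.
Proof.
move=> [Lh lv H]; apply: eq_of_dist_lt => e e0.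
have e2 : 0 < e / 2 by rewrite divr_gt0.
have [s [S [cS hs vs]]] := H _ e2.
have Ls := calculus_L2 HE lf0 muE cS; have lS := calculus_l2 HE cS lf0.
rewrite -(subrKA (nrm mu s)) {2}(nrm_calculus HE lf0 muE cS).
rewrite (le_trans (ler_normD _ _))// [leRHS]splitr lerD// ?[X in _ <= X]ltW//.
  by rewrite (le_trans (nrm_sub Lh Ls))// ltW.
by rewrite distrC (le_trans (nrm_sub lv.1 lS.1))// ltW.
Qed.

Lemma approx_ip h v h' v' : approx h v -> approx h' v' ->
  ip mu h h' = l2ip v v'.
Proof.
move=> H H'; have [Lh lv _] := H; have [Lh' lv' _] := H'.
rewrite /l2ip; have -> := ip_polar Lh Lh'; have -> := ip_polar lv.1 lv'.1.
congr (_ * _); apply: eq_bigr => n _; congr (_ * (_ ^+ 2)%:C).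
exact: approx_nrm (approxD H (approxZ _ H')).
Qed.

(* w is b(U) u, without mentioning the operator b(U). *)
Definition approx_mul b u w := forall e : R, 0 < e ->
  exists z Z, [/\ calculus E z Z, forall x, normc (b x - z x) <= e &
    nrm cnt (fun k => w k - Z u k) <= e].

(** If s, S approximate h, u and z, Z approximate b, w, then z s and Z S f0 approximate b h and w
    together. *)
Lemma approxM b h u w : cmeasurable b -> (forall x, normc (b x) <= 1) ->
    l2 J w -> approx h u -> approx_mul b u w ->
  approx (fun x => b x * h x) w.
Proof.
move=> mb b1 lw [Lh lu H] HB.
have Lbh : L2 mu (fun x => b x * h x).
  apply: (L2_bounded _ ler01 _ Lh); first by apply: cmeasurableM => //; exact: Lh.1.
  by move=> x; rewrite normcM ler_wpM2r ?normc_ge0.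
split=> // e e0; set N := nrm mu h.
have N0 : 0 <= N by exact: nrm_ge0.
(* The minima with 1 give a norm of s at most N + 1 and |z| <= 2. The errors are then at most e/4 +
   e/4 for b h, and e/4 + 2 (e/4) for w. *)
pose e1 := Num.min 1 (e / 4); pose eta := Num.min 1 (e / (4 * (N + 1))).
have N1 : 0 < 4 * (N + 1) by rewrite mulr_gt0// ltr_wpDl.
have e10 : 0 < e1 by rewrite lt_min ltr01 divr_gt0.
have eta0 : 0 < eta by rewrite lt_min ltr01 divr_gt0.
have [s [S [cS hs us]]] := H _ e10; have [z [Z [cZ bz wZ]]] := HB _ eta0.
have [V [cV VE]] := calculusM HE cZ cS.
have Ls := calculus_L2 HE lf0 muE cS; have lS := calculus_l2 HE cS lf0.
have LV := calculus_L2 HE lf0 muE cV.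
have e1le : e1 <= 1 by rewrite ge_min lexx.
have e1le' : e1 <= e / 4 by rewrite ge_min lexx orbT.
have etale : eta <= 1 by rewrite ge_min lexx.
have etaN : eta * (N + 1) <= e / 4.
  have : eta <= e / (4 * (N + 1)) by rewrite ge_min lexx orbT.
  rewrite ler_pdivlMr// mulrCA mulrC => H1.
  by rewrite ler_pdivlMr.
have eta4 : eta <= e / 4.
  by rewrite (le_trans _ etaN)// ler_peMr ?(ltW eta0)// lerDr.
exists (fun x => z x * s x), V; split => //.
  have Lbs : L2 mu (fun x => b x * s x).
    apply: (L2_bounded _ ler01 _ Ls); first by apply: cmeasurableM => //; exact: Ls.1.
    by move=> x; rewrite normcM ler_wpM2r ?normc_ge0.
  have sN : nrm mu s <= N + 1.
    have := nrm_sub Ls Lh; rewrite nrm_distC ler_norml => /andP[_ ?].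
    rewrite -lerBlDl; apply: le_trans e1le; apply: ltW; exact: le_lt_trans hs.
  rewrite (le_lt_trans (nrm_tri Lbh Lbs LV))//.
  have A1 : nrm mu (fun x => b x * h x - b x * s x) <= 1 * nrm mu (fun x => h x - s x).
    apply: le_nrm => //; [exact: (L2B Lbh Lbs).1| |exact: L2B].
    by move=> x; rewrite -mulrBr normcM ler_wpM2r ?normc_ge0.
  have A2 : nrm mu (fun x => b x * s x - z x * s x) <= eta * nrm mu s.
    apply: le_nrm => //; [exact: (L2B Lbs LV).1|exact: ltW|].
    by move=> x; rewrite -mulrBl normcM ler_wpM2r ?normc_ge0.
  have A3 : eta * nrm mu s <= eta * (N + 1) by rewrite ler_wpM2l// ltW.
  by move: hs A1 A2 A3; lra.
rewrite VE//.
have lZu := calculus_l2 HE cZ lu; have lZS := calculus_l2 HE cZ lS.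
have := nrm_tri lw.1 lZu.1 lZS.1; move=> /le_lt_trans; apply.
have := calculusB HE cZ lu lS => EB.
have zC x : normc (z x) <= 2.
  have -> : z x = b x - (b x - z x) by rewrite opprB addrC subrK.
  by rewrite (le_trans (normcD _ _))// normcN -[2]/(1 + 1 : R) lerD// (le_trans (bz x)).
have := nrm_calculus_le HE cZ (ler0n R 2) zC (l2B lu lS); rewrite EB => B1.
by move: us wZ B1; lra.
Qed.

End Vector.

End Approximation.

(** * Multiplication by zeta corresponds to U *)

Section MultiplicationByZeta.
Context (R : realType) (J : set int) (U : operator R).
Context (E : set (circle_borel R) -> operator R).
Context (HE : spectral_measure J U E).
Implicit Types (f g u v w : int -> R[i]).
Implicit Types (h b s z : circle_borel R -> R[i]) (S Z : operator R) (a : R[i]).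
Let cnt : {measure set int -> \bar R} := @counting int R.
Let zeta : circle_borel R -> R[i] := fun x => val x.

Lemma normc_circle (x : circle_borel R) : normc (val x) = 1.
Proof. by case: x => x /= /eqP /(congr1 (@complex.Re R)). Qed.

(** The preimage of an open half-line under a function with Lipschitz constant 1 is relatively open,
    and half-lines generate the Borel sets of the line. *)
Lemma cmeasurable_circle (F : R[i] -> R) :
    (forall x y, `|F x - F y| <= normc (x - y)) ->
  measurable_fun setT (fun x : circle_borel R => F (val x)).
Proof.
move=> FL; apply: (measurability _ (RGenOInfty.measurableE R)) => //.
move=> /= _ [_ [c ->] <-]; rewrite setTI; apply: sub_sigma_algebra.
exists [set x : R[i]^o | c < F x]; last first.
  by apply/seteqP; split => x /=; rewrite in_itv /= andbT.
rewrite openE => x /= cx; apply/nbhs_ballP; exists (F x - c)%:C => /=.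
  by rewrite ltcR subr_gt0.
move=> y; rewrite -ball_normE /= -[`|x - y|]/((normc (x - y))%:C) ltcR => xy.
have := FL x y; rewrite ler_norml => /andP[_ xy'].
by rewrite -subr_gt0; move: xy xy'; lra.
Qed.

Lemma cmeasurable_zeta : cmeasurable zeta.
Proof.
split; apply: cmeasurable_circle => x y.
  by rewrite (le_trans _ (normc_Re _))//; case: x y => ? ? [].
by rewrite (le_trans _ (normc_Im _))//; case: x y => ? ? [].
Qed.

Lemma normc_sum_polar_le (c : 'I_4 -> R[i]) (M : R) :
  (forall n, normc (c n) <= M) -> normc (4^-1 * \sum_(n < 4) (- 'i) ^+ n * c n) <= M.
Proof.
move=> cM; have n1 n : normc ((- 'i : R[i]) ^+ n) = 1.
  by rewrite -conj_i -conjcX normcJ normc_iX.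
have -> : (4 : R[i]) = (4 : R)%:C by rewrite rmorph_nat.
rewrite normcM normcV normcC ger0_norm//.
rewrite mulrC ler_pdivrMr// !big_ord_recl big_ord0 addr0.
have H n (m : nat) : normc ((- 'i) ^+ m * c n) <= M by rewrite normcM n1 mul1r.
have -> : M * 4 = M + (M + (M + M)) by ring.
by do 3![rewrite (le_trans (normcD _ _))// lerD//].
Qed.

(** Both forms are polarized with the same weights. The difference averages four unimodular
    multiples of integrals of zeta - z, against measures of mass at most the square of the sum of
    the norms of f and g. *)
Lemma weak_integral_calculus f g z Z (e : R) : calculus E z Z -> 0 <= e ->
    (forall x, normc (zeta x - z x) <= e) -> l2 J f -> l2 J g ->
  normc (l2ip f (U g) - l2ip f (Z g)) <= e * (nrm cnt f + nrm cnt g) ^+ 2.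
Proof.
move=> cZ e0 ze lf lg; rewrite (spectral_integral HE)// /weak_integral_id.
pose F (n : 'I_4) k := f k + 'i ^+ n * g k.
have lF n : l2 J (F n) by apply: l2D => //; exact: l2Z.
have lZ := calculus_l2 HE cZ.
have -> : l2ip f (Z g) = 4^-1 * \sum_(n < 4) (- 'i) ^+ n * l2ip (F n) (Z (F n)).
  rewrite -[LHS](sum_polar (l2ip f (Z f)) _ (l2ip g (Z f)) (l2ip g (Z g))).
  congr (_ * _); apply: eq_bigr => n _; congr (_ * _).
  have -> : Z (F n) = fun k => Z f k + 'i ^+ n * Z g k.
    have := calculus_linear HE cZ ('i ^+ n) lg lf; rewrite /F => H.
    by rewrite (_ : (fun k => _) = (fun k => 'i ^+ n * g k + f k));
      [rewrite H|]; apply/funext => k; rewrite addrC.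
  have LF := (lF n).1; rewrite /l2ip.
  have Lf := lf.1; have Lg := lg.1; have LZf := (lZ _ lf).1.
  have LZg := (lZ _ lg).1; have L1 := L2Z (mu := cnt) ('i ^+ n) LZg.
  have L2' := L2Z (mu := cnt) ('i ^+ n) Lg.
  have -> := ipDr (mu := cnt) LF LZf L1.
  have -> := ipZr (mu := cnt) ('i ^+ n) LF LZg.
  have -> := ipDl (mu := cnt) LZf Lf L2'; have -> := ipDl (mu := cnt) LZg Lf L2'.
  have -> := ipZl (mu := cnt) ('i ^+ n) LZf Lg.
  have -> := ipZl (mu := cnt) ('i ^+ n) LZg Lg.
  by ring.
rewrite -mulrBr -sumrB; under eq_bigr do rewrite -mulrBr.
apply: normc_sum_polar_le => n.
have [mu muE] := spectral_scalar HE (lF n).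
rewrite -(cintegral_calculus HE (lF n) muE cZ) (raw_cintegralE muE).
have iz : cintegrable mu zeta.
  apply: (bounded_cintegrable HE (lF n) muE cmeasurable_zeta (C := 1)) => x.
  by rewrite normc_circle.
have i1 := calculus_cintegrable HE (lF n) muE cZ.
have mzz : cmeasurable (fun x => zeta x - z x).
  have := cmeasurableD cmeasurable_zeta (cmeasurableZ (-1) (calculus_cmeasurable cZ)).
  by under eq_fun do rewrite mulN1r.
(* As a scalar product with the constant 1, the integral is open to Cauchy-Schwarz. *)
have -> : cintegral mu zeta - cintegral mu z =
    ip mu (fun _ => 1) (fun x => zeta x - z x).
  rewrite -mulN1r -cintegralZ// -cintegralD//; last exact: cintegrableZ.
  by congr cintegral; apply/funext => x; rewrite mulN1r rmorph1 mul1r.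
have c1 : calculus E (fun _ => 1) (E setT).
  by have := calculus_indic E measurableT; congr calculus; apply/funext => x;
    rewrite indicT.
have L1 := calculus_L2 HE (lF n) muE c1.
apply: le_trans (normc_ip_le L1 (bounded_L2 HE (lF n) muE mzz e0 ze)) _.
rewrite (nrm_calculus HE (lF n) muE c1) (spectral_setT HE)//.
apply: (@le_trans _ _ (nrm cnt (F n) * (e * nrm cnt (F n)))).
  by rewrite ler_wpM2l ?nrm_ge0//; exact: (nrm_bounded HE (lF n) muE mzz e0 ze).
rewrite mulrCA -expr2 ler_wpM2l// lerXn2r ?nnegrE ?addr_ge0 ?nrm_ge0//.
have := nrmD lf.1 (L2Z ('i ^+ n) lg.1).
by rewrite nrmZ ?normc_iX ?mul1r//; exact: lg.1.
Qed.

(** The weak estimate is tested on D = U g - Z g divided by its norm, which returns the norm of D.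
    With both vectors of norm at most 1 the factor is (1 + 1)^2 = 4. *)
Lemma nrm_U_calculus g z Z (e : R) : calculus E z Z -> 0 <= e ->
    (forall x, normc (zeta x - z x) <= e) -> l2 J g -> l2 J (U g) ->
  nrm cnt g <= 1 -> nrm cnt (fun k => U g k - Z g k) <= 4 * e.
Proof.
move=> cZ e0 ze lg lU g1; have lZ := calculus_l2 HE cZ lg.
set D := fun k => _; have lD : l2 J D by exact: l2B.
have [->|D0] := eqVneq (nrm cnt D) 0; first by rewrite mulr_ge0.
have Dp : 0 < nrm cnt D by rewrite lt_neqAle eq_sym D0 nrm_ge0.
pose c : R[i] := ((nrm cnt D)^-1)%:C.
have cE : normc c = (nrm cnt D)^-1 by rewrite normcC ger0_norm// invr_ge0 ltW.
have lf : l2 J (fun k => c * D k) by exact: l2Z.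
have := weak_integral_calculus cZ e0 ze lf lg.
have -> : l2ip (fun k => c * D k) (U g) - l2ip (fun k => c * D k) (Z g) =
    (nrm cnt D)%:C.
  rewrite /l2ip; have -> := ipZl (mu := cnt) c lU.1 lD.1.
  have -> := ipZl (mu := cnt) c lZ.1 lD.1.
  rewrite -mulrBr; have -> : ip cnt D (U g) - ip cnt D (Z g) = ip cnt D D.
    have := ipDr (mu := cnt) lD.1 lU.1 (L2Z (mu := cnt) (-1) lZ.1).
    have -> := ipZr (mu := cnt) (-1) lD.1 lZ.1.
    rewrite mulN1r => <-; congr (ip cnt D _); apply/funext => k.
    by rewrite mulN1r.
  rewrite ipff /c; have -> : ((nrm cnt D)^-1)%:C^* = ((nrm cnt D)^-1)%:C :> R[i].
    by apply/eqP; rewrite eq_complex /= oppr0 !eqxx.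
  by rewrite -rmorphM expr2 mulKf.
rewrite normcC ger0_norm ?nrm_ge0// nrmZ ?cE ?mulVf//; last exact: lD.1.
move=> /le_trans; apply; rewrite mulrC ler_wpM2r//.
have -> : 4 = (1 + 1) ^+ 2 :> R by ring.
by rewrite lerXn2r ?nnegrE ?addr_ge0 ?nrm_ge0// lerD2l.
Qed.

Lemma approx_mul_zeta g : l2 J g -> l2 J (U g) -> nrm cnt g <= 1 ->
  approx_mul E zeta g (U g).
Proof.
move=> lg lU g1 e e0; have e4 : 0 < e / 4 by rewrite divr_gt0.
have z1 (x : circle_borel R) : normc (zeta x) <= 1 by rewrite normc_circle.
have [z [Z [cZ ze]]] := calculus_uniform E cmeasurable_zeta ler01 z1 e4.
exists z, Z; split => // [x|].
  by rewrite (le_trans (ze x))// ler_pdivrMr// ler_peMr ?(ltW e0)// ler1n.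
have := nrm_U_calculus cZ (ltW e4) ze lg lU g1.
by rewrite mulrC divfK.
Qed.

(** With Y the adjoint of Z, g is close to Y Z g because |z|^2 is close to 1, and Y Z g is close to
    Y U g because Z g is close to U g. *)
Lemma approx_mul_zetaV g : l2 J g -> l2 J (U g) -> nrm cnt g <= 1 ->
  approx_mul E (fun x => (zeta x)^*) (U g) g.
Proof.
move=> lg lU g1 e' e'0; pose e := Num.min 1 e'.
have e0 : 0 < e by rewrite lt_min ltr01.
have e1 : e <= 1 by rewrite ge_min lexx.
have ee : e <= e' by rewrite ge_min lexx orbT.
(* Here 11 = 3 + 2 * 4: the error of 1 - |z|^2 is at most 3 t, and Y, bounded by 2, acts on an error
   of at most 4 t. The minimum with 1 above ensures |z| <= 2. *)
pose t := e / 11; have t0 : 0 < t by rewrite divr_gt0.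
have z1 (x : circle_borel R) : normc (zeta x) <= 1 by rewrite normc_circle.
have [z [Z [cZ ze]]] := calculus_uniform E cmeasurable_zeta ler01 z1 t0.
have [Y [cY adj]] := calculusJ HE cZ; have [V [cV VE]] := calculusM HE cY cZ.
have tE : e = 11 * t by rewrite mulrC divfK.
exists (fun x => (z x)^*), Y; split => // [x|].
  by rewrite -rmorphB normcJ (le_trans (ze x))//; lra.
have zC x : normc (z x) <= 2.
  have -> : z x = zeta x - (zeta x - z x) by rewrite opprB addrC subrK.
  rewrite (le_trans (normcD _ _))// normcN -[2]/(1 + 1 : R) lerD//.
  by rewrite (le_trans (ze x))//; lra.
have zC' x : normc ((z x)^*) <= 2 by rewrite normcJ.
have lZ := calculus_l2 HE cZ lg; have lYZ := calculus_l2 HE cY lZ.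
have lYU := calculus_l2 HE cY lU.
apply: le_trans (nrm_tri lg.1 lYZ.1 lYU.1) _.
have B1 : nrm cnt (fun k => Y (Z g) k - Y (U g) k) <= 2 * (4 * t).
  have := nrm_calculus_le HE cY (ler0n R 2) zC' (l2B lZ lU).
  rewrite (calculusB HE cY lZ lU) => /le_trans; apply.
  by rewrite ler_wpM2l// nrm_distC; exact: nrm_U_calculus (ltW t0) ze lg lU g1.
have c1 : calculus E (fun x => 1 - (z x)^* * z x) (fun f k => E setT f k - V f k).
  have := calculusD (calculus_indic E measurableT) (calculusZ (-1) cV).
  congr calculus; [apply/funext => x|apply/funext => f; apply/funext => k].
    by rewrite indicT mulN1r.
  by rewrite mulN1r.
have zz x : normc (1 - (z x)^* * z x) <= 3 * t.
  have -> : 1 - (z x)^* * z x = (zeta x)^* * (zeta x - z x) +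
      (zeta x - z x)^* * z x.
    have : (zeta x)^* * zeta x = 1 by rewrite mulJc normc_circle expr1n.
    by move=> <-; rewrite rmorphB; ring.
  apply: le_trans (normcD _ _) _; rewrite !normcM !normcJ normc_circle mul1r.
  have : normc (zeta x - z x) * normc (z x) <= t * 2.
    by apply: ler_pM; rewrite ?normc_ge0.
  by have := ze x; lra.
have t3 : 0 <= 3 * t by rewrite mulr_ge0// ltW.
have := nrm_calculus_le HE c1 t3 zz lg.
rewrite (spectral_setT HE)// VE// => B2.
have B3 : 3 * t * nrm cnt g <= 3 * t by rewrite ler_piMr.
apply: le_trans ee; rewrite tE.
apply: le_trans (lerD (le_trans B2 B3) B1) _; lra.
Qed.

End MultiplicationByZeta.

(** * Block diagonal operators on the standard basis *)

Section BlockOperators.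
Context (R : realType) (beta : int -> R[i]).
Context (beta_le1 : forall k, normc (beta k) <= 1).
Implicit Types (P : pred int) (j k x : int).
Let cnt : {measure set int -> \bar R} := @counting int R.

Lemma evenzS k : evenz (k + 1) = ~~ evenz k.
Proof.
rewrite /evenz !dvdzE !dvdn2; case: k => n.
  by rewrite -PoszD addn1.
have -> : Negz n + 1 = - n%:Z by rewrite NegzE -addn1 PoszD opprD addrNK.
by rewrite abszN /= negbK.
Qed.

Lemma oddzS k : oddz (k + 1) = ~~ oddz k.
Proof. by rewrite /oddz evenzS. Qed.

(** For such P the blocks cover each site exactly once; V and W are thereby treated together. *)
Definition alternating P := forall k, P (k + 1) = ~~ P k.

Lemma alternatingB P k : alternating P -> P (k - 1) = ~~ P k.
Proof. by move=> aP; rewrite -[k in RHS](subrK 1) aP negbK. Qed.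

Lemma block_operatorE P (f : int -> R[i]) k : block_operator P beta f k =
  if P k then (rho beta k)%:C * f (k - 1) + (beta k)^* * f k
  else - beta (k + 1) * f k + (rho beta (k + 1))%:C * f (k + 1).
Proof. by rewrite /block_operator !mxE /=. Qed.

Lemma block_operator_linear P (a b : R[i]) f g :
  block_operator P beta (fun k => a * f k + b * g k) =
  fun k => a * block_operator P beta f k + b * block_operator P beta g k.
Proof.
by apply/funext => k; rewrite !block_operatorE; case: ifP => _; ring.
Qed.

(** For k in P the sites k - 1 and k carry the block theta_k; this is its second column, and
    [block_delta_upper] gives the first. *)
Lemma block_delta_lower P k : alternating P -> P k ->
  block_operator P beta (delta R k) = fun x =>
    (rho beta k)%:C * delta R (k - 1) x + (beta k)^* * delta R k x.
Proof.
move=> aP Pk; apply/funext => x; rewrite block_operatorE /delta.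
have [Px|Px] := boolP (P x).
  have -> : x - 1 == k = false.
    by apply/negbTE/eqP => E; move: Pk; rewrite -E alternatingB// Px.
  have -> : x == k - 1 = false.
    by apply/negbTE/eqP => E; move: Px; rewrite E alternatingB// Pk.
  rewrite !mulr0 !add0r; have [->//|] := eqVneq x k; by rewrite !mulr0.
have -> : x == k = false by apply/negbTE; apply: contraNneq Px => ->.
have -> : (x == k - 1) = (x + 1 == k) by rewrite eq_sym subr_eq eq_sym.
rewrite !mulr0 add0r addr0; have [->//|] := eqVneq (x + 1) k.
by rewrite !mulr0.
Qed.

Lemma block_delta_upper P k : alternating P -> P k ->
  block_operator P beta (delta R (k - 1)) = fun x =>
    - beta k * delta R (k - 1) x + (rho beta k)%:C * delta R k x.
Proof.
move=> aP Pk; apply/funext => x; rewrite block_operatorE /delta.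
have [Px|Px] := boolP (P x).
  have -> : x == k - 1 = false.
    by apply/negbTE/eqP => E; move: Px; rewrite E alternatingB// Pk.
  rewrite !mulr0 addr0 add0r (inj_eq (addIr _)).
  by have [->//|] := eqVneq x k; rewrite !mulr0.
have -> : x == k = false by apply/negbTE; apply: contraNneq Px => ->.
have -> : x + 1 == k - 1 = false.
  apply/negbTE/eqP => E; move: Px; rewrite -[x](addrK 1) E.
  by rewrite !alternatingB// negbK Pk.
rewrite !mulr0 !addr0; have [->|] := eqVneq x (k - 1); first by rewrite subrK.
by rewrite !mulr0.
Qed.

(** This is what makes theta_k unitary. The weak bound on |beta_k| admits the cut site, where beta_k
    = 1 and rho_k = 0. *)
Lemma rho_sqr k : (rho beta k)%:C * (rho beta k)%:C + (beta k)^* * beta k = 1.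
Proof.
rewrite mulJc -rmorphM -rmorphD -expr2 sqr_sqrtr ?subrK ?rmorph1//.
by rewrite subr_ge0 expr_le1// normc_ge0.
Qed.

Lemma L2_block_delta P k : alternating P ->
  L2 cnt (block_operator P beta (delta R k)).
Proof.
move=> aP; have L a b i j : L2 cnt (fun x => a * delta R i x + b * delta R j x).
  by apply: L2D; apply: L2Z; exact: L2_delta.
have [Pk|Pk] := boolP (P k); first by rewrite block_delta_lower//; exact: L.
rewrite -[k](addrK 1) block_delta_upper ?aP//; exact: L.
Qed.

Lemma L2_block_block P P' k : alternating P -> alternating P' ->
  L2 cnt (block_operator P beta (block_operator P' beta (delta R k))).
Proof.
move=> aP aP'.
have L a b i j : L2 cnt (block_operator P beta
    (fun x => a * delta R i x + b * delta R j x)).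
  rewrite block_operator_linear.
  by apply: L2D; apply: L2Z; exact: L2_block_delta.
have [Pk|Pk] := boolP (P' k); first by rewrite [X in L2 _ (_ X)]block_delta_lower//.
by rewrite -[k](addrK 1) [X in L2 _ (_ X)]block_delta_upper ?aP'.
Qed.

Lemma block_delta_orthonormal P j k : alternating P ->
  l2ip (block_operator P beta (delta R j)) (block_operator P beta (delta R k)) =
  (j == k)%:R.
Proof.
move=> aP; have LV := L2_block_delta k aP; rewrite /l2ip.
have ipE a b i i' : ip cnt (fun x => a * delta R i x + b * delta R i' x)
    (block_operator P beta (delta R k)) =
  a^* * block_operator P beta (delta R k) i + b^* * block_operator P beta (delta R k) i'.
  have := ipDl (mu := cnt) LV (L2Z (mu := cnt) a (@L2_delta R i))
    (L2Z (mu := cnt) b (@L2_delta R i')) => ->.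
  have -> := ipZl (mu := cnt) a LV (@L2_delta R i).
  have -> := ipZl (mu := cnt) b LV (@L2_delta R i').
  by rewrite !ip_deltal.
have CJ (c : R) : c%:C^* = c%:C :> R[i].
  by apply/eqP; rewrite eq_complex /= oppr0 !eqxx.
have [Pj|Pj] := boolP (P j).
  have -> := block_delta_lower aP Pj; rewrite ipE !block_operatorE.
  rewrite alternatingB// Pj /= subrK conjCK CJ.
  rewrite -[RHS]mul1r -[X in _ = X * _](rho_sqr j) /delta; ring.
have Pj1 : P (j + 1) by rewrite aP.
have := block_delta_upper aP Pj1; rewrite addrK => ->.
rewrite ipE !block_operatorE (negPf Pj) Pj1 addrK rmorphN CJ.
rewrite -[RHS]mul1r -[X in _ = X * _](rho_sqr (j + 1)) /delta; ring.
Qed.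

(** The column formulas are inverted by the adjoint of theta_k. This and [delta_upperE] put delta_k
    into the span of the images of the standard basis. *)
Lemma delta_lowerE P k : alternating P -> P k ->
  delta R k = fun x => (rho beta k)%:C * block_operator P beta (delta R (k - 1)) x
    + beta k * block_operator P beta (delta R k) x.
Proof.
move=> aP Pk; apply/funext => x; rewrite block_delta_upper// block_delta_lower//.
by rewrite -[LHS]mul1r -{1}(rho_sqr k); ring.
Qed.

Lemma delta_upperE P k : alternating P -> P k ->
  delta R (k - 1) = fun x =>
    - (beta k)^* * block_operator P beta (delta R (k - 1)) x
    + (rho beta k)%:C * block_operator P beta (delta R k) x.
Proof.
move=> aP Pk; apply/funext => x; rewrite block_delta_upper// block_delta_lower//.
by rewrite -[LHS]mul1r -{1}(rho_sqr k); ring.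
Qed.

End BlockOperators.

(** * Transport of orthonormal bases from l^2(J) to L^2(mu) *)

Section OrthonormalBasis.
Context (R : realType) (J : set int) (U : operator R).
Context (E : set (circle_borel R) -> operator R).
Context (HE : spectral_measure J U E).
Context (f0 : int -> R[i]) (lf0 : l2 J f0).
Implicit Types (v : int -> R[i]) (w : int -> int -> R[i]).
Let cnt : {measure set int -> \bar R} := @counting int R.

(** Indices may repeat in the list, so that adding combinations is concatenation. *)
Definition finite_span w v := exists t : seq (int * R[i]),
  (forall p, p \in t -> J p.1) /\ v = fun x => \sum_(p <- t) p.2 * w p.1 x.

Lemma finite_span1 w (a : R[i]) k : J k -> finite_span w (fun x => a * w k x).
Proof.
move=> Jk; exists [:: (k, a)]; split=> [p|]; first by rewrite inE => /eqP ->.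
by apply/funext => x; rewrite big_seq1.
Qed.

Lemma finite_spanD w v v' : finite_span w v -> finite_span w v' ->
  finite_span w (fun x => v x + v' x).
Proof.
move=> [t [Jt ->]] [t' [Jt' ->]]; exists (t ++ t'); split=> [p|].
  by rewrite mem_cat => /orP[/Jt|/Jt'].
by apply/funext => x; rewrite big_cat.
Qed.

Lemma finite_spanZ w (a : R[i]) v : finite_span w v ->
  finite_span w (fun x => a * v x).
Proof.
move=> [t [Jt ->]]; exists [seq (p.1, a * p.2) | p <- t]; split=> [p|].
  by move=> /mapP[q /Jt Jq ->].
apply/funext => x; rewrite big_map mulr_sumr; apply: eq_bigr => p _ /=.
by rewrite mulrA.
Qed.

Lemma finite_span_sum w (I : eqType) (s : seq I) (F : I -> int -> R[i]) :
  (forall i, i \in s -> finite_span w (F i)) ->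
  finite_span w (fun x => \sum_(i <- s) F i x).
Proof.
elim: s => [|i s IH] HF.
  exists [::]; split=> //; apply/funext => x; by rewrite !big_nil.
rewrite (_ : (fun x => _) = fun x => F i x + \sum_(j <- s) F j x).
  apply: finite_spanD; first by apply: HF; rewrite mem_head.
  by apply: IH => j js; apply: HF; rewrite inE js orbT.
by apply/funext => x; rewrite big_cons.
Qed.

(** An [orthonormal_basis] asks for coefficients depending on the index alone; repeated indices are
    merged by adding their coefficients. *)
Lemma sum_pairs_undup (T : Type) (t : seq (int * R[i])) (F : int -> T -> R[i]) x :
  \sum_(p <- t) p.2 * F p.1 x =
  \sum_(k <- undup [seq p.1 | p <- t]) (\sum_(p <- t | p.1 == k) p.2) * F k x.
Proof.
under [RHS]eq_bigr => k _ do rewrite mulr_suml big_mkcond.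
rewrite exchange_big /= big_seq [RHS]big_seq; apply: eq_bigr => p pt.
have pu : p.1 \in undup [seq q.1 | q <- t] by rewrite mem_undup map_f.
rewrite (bigD1_seq p.1 pu (undup_uniq _))//= eqxx big1 ?addr0// => k /negPf kp.
by rewrite eq_sym kp.
Qed.

Context (mu : {measure set (circle_borel R) -> \bar R}).
Context (muE : forall A, measurable A -> diagonal_measure E f0 A = mu A).

Lemma approx_sum (I : eqType) (s : seq I) (c : I -> R[i])
    (h : I -> circle_borel R -> R[i]) (v : I -> int -> R[i]) :
  (forall i, i \in s -> approx J E f0 mu (h i) (v i)) ->
  approx J E f0 mu (fun x => \sum_(i <- s) c i * h i x)
    (fun k => \sum_(i <- s) c i * v i k).
Proof.
elim: s => [|i s IH] H.
  have := approxZ HE lf0 muE 0 (approx1 HE lf0 muE).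
  by congr approx; apply/funext => x; rewrite big_nil mul0r.
have A := approxZ HE lf0 muE (c i) (H i (mem_head _ _)).
have := approxD HE lf0 muE A (IH (fun j js => H j (@mem_behead _ (i :: s) j js))).
by congr approx; apply/funext => x; rewrite big_cons.
Qed.

(* A combination of the w k corresponds to the conjugate combination of the
   q k; the unimodular factor u does not affect norms. *)
Lemma approx_orthonormal_basis w (q : int -> circle_borel R -> R[i])
    (u : circle_borel R -> R[i]) :
    cmeasurable u -> (forall x, normc (u x) = 1) ->
    (forall k, J k -> approx J E f0 mu (fun x => (q k x)^* * u x) (w k)) ->
    (forall j k, J j -> J k -> l2ip (w j) (w k) = (j == k)%:R) ->
    (forall v, l2 J v -> forall e : R, 0 < e ->
       exists2 v', finite_span w v' & nrm cnt (fun k => v k - v' k) < e) ->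
  orthonormal_basis (diagonal_measure E f0) J q.
Proof.
move=> mu_ u1 qw ON dense.
have uu x : (u x)^* * u x = 1 by rewrite mulJc u1 expr1n.
have Lh k : J k -> L2 mu (fun x => (q k x)^* * u x) by move=> /qw [].
have qE k : q k = fun x => (((q k x)^* * u x)^*) * u x.
  by apply/funext => x; rewrite rmorphM /= conjCK -mulrA uu mulr1.
split.
- move=> k Jk; rewrite (raw_L2E muE).
  have mq : cmeasurable (q k).
    rewrite qE; apply: cmeasurableM => //; apply: cmeasurableJ.
    by case: (Lh _ Jk).
  apply: (L2_bounded mq ler01 _ (Lh _ Jk)) => x.
  by rewrite normcM normcJ u1 mulr1 mul1r.
- move=> j k Jj Jk; rewrite (raw_ipE muE).
  (* Conjugation reverses the order: the scalar product of conj(q_k) u with conj(q_j) u is that of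
     q_j with q_k. *)
  have := approx_ip HE lf0 muE (qw _ Jk) (qw _ Jj); rewrite ON// eq_sym => <-.
  congr cintegral; apply/funext => x.
  by rewrite rmorphM /= conjCK mulrACA uu mulr1 mulrC.
- move=> f; rewrite (raw_L2E muE) => Lf eps eps0.
  have [Se Se0 SeE] : exists2 e : R, 0 < e & (e + e) ^+ 2 < eps.
    (* For e <= 1 and e <= eps / 8, (e + e)^2 <= 4 e <= eps / 2. Two errors e will be added, and the
       goal bounds a square norm. *)
    exists (Num.min 1 (eps / 8)).
      by rewrite lt_min ltr01 divr_gt0.
    set e := Num.min _ _.
    have e1 : e <= 1 by rewrite ge_min lexx.
    have e8 : e <= eps / 8 by rewrite ge_min lexx orbT.
    have e0 : 0 < e by rewrite lt_min ltr01 divr_gt0.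
    have : e * e <= e * 1 by rewrite ler_wpM2l// ltW.
    by rewrite expr2 mulrDl !mulrDr; move: e8 eps0; lra.
  (* The approximation takes place on the antiunitary image F of f and is carried back at the
     end. *)
  pose F x := (f x)^* * u x.
  have LF : L2 mu F.
    apply: (L2_bounded _ ler01 _ Lf).
      by apply: cmeasurableM => //; apply: cmeasurableJ; case: Lf.
    by move=> x; rewrite /F normcM normcJ u1 mulr1 mul1r.
  have [s [S [cS Fs]]] := calculus_dense HE lf0 muE LF Se0.
  have lS := calculus_l2 HE cS lf0.
  have [v' [t [Jt v'E]] Sv'] := dense _ lS _ Se0.
  have Jp p : p \in t -> J p.1 by exact: Jt.
  pose c k := (\sum_(p <- t | p.1 == k) p.2)^*.
  exists (undup [seq p.1 | p <- t]), c; split.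
    by move=> k; rewrite mem_undup => /mapP[p /Jt Jp1 ->].
  pose G x := \sum_(p <- t) p.2 * ((q p.1 x)^* * u x).
  have aG : approx J E f0 mu G v'.
    by rewrite v'E; apply: approx_sum => p /Jt; exact: qw.
  have aB : nrm mu (fun x => s x - G x) = nrm cnt (fun k => S f0 k - v' k).
    have A := approxZ HE lf0 muE (-1) aG.
    have := approx_nrm HE lf0 muE (approxD HE lf0 muE (approx_calculus HE lf0 muE cS) A).
    under eq_fun do rewrite mulN1r; under [in RHS]eq_fun do rewrite mulN1r.
    by [].
  have LG : L2 mu G by case: aG.
  have Ls := calculus_L2 HE lf0 muE cS.
  have FG : nrm mu (fun x => F x - G x) < Se + Se.
    by rewrite (le_lt_trans (nrm_tri LF Ls LG))// ltrD// aB.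
  rewrite (raw_sqnormE muE).
  rewrite (_ : sqnorm mu _ = sqnorm mu (fun x => F x - G x)); last first.
    apply: eq_integral => x _; congr (_ ^+ 2)%:E.
    rewrite /F /G (sum_pairs_undup t (fun k x => (q k x)^* * u x)).
    rewrite [X in _ = normc (_ - X)](_ : _ =
      (\sum_(k <- undup [seq p.1 | p <- t]) c k * q k x)^* * u x).
      by rewrite -mulrBl normcM u1 mulr1 -rmorphB normcJ.
    rewrite rmorph_sum mulr_suml; apply: eq_bigr => k _ /=.
    by rewrite rmorphM /= conjCK mulrA.
  rewrite (sqnormE (L2B LF LG)) lte_fin (lt_trans _ SeE)//.
  by rewrite ltrXn2r ?nnegrE ?nrm_ge0// addr_ge0// ltW.
Qed.

End OrthonormalBasis.

(** Solving one row of the transfer recursion for yb yields a row of theta. Here xb, yb are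
    conj(p_(k-1)), conj(r_(k-1)) for k even, and conj(r_(k-1)), zeta conj(p_(k-1)) for k odd; u is
    p_k0. *)
Lemma theta_upper (R : realType) (a c y xb yb u : R[i]) : c != 0 ->
  y = c^-1 * (a * xb + yb) -> yb * u = - a * (xb * u) + c * (y * u).
Proof. by move=> c0 ->; field. Qed.

(** Eliminating yb between the two rows leaves the coefficient c^2 + |a|^2 = 1 in front of xb. *)
Lemma theta_lower (R : realType) (a ab c x y xb yb u : R[i]) :
  c != 0 -> c * c + ab * a = 1 ->
  x = c^-1 * (a * xb + yb) -> y = c^-1 * (xb + ab * yb) ->
  y * u = c * (xb * u) + ab * (x * u).
Proof.
move=> c0 ca -> ->; rewrite -[xb in LHS]mul1r -ca; field.
exact: c0.
Qed.

(** * Induction on a half-lattice J cut at m: m = k0 on the right, m = k0 + 1 on the left *)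

Section HalfLattice.
Context (R : realType) (alpha : int -> R[i]) (m k0 : int) (J : set int).
Context (alpha_lt1 : forall k, `|alpha k| < 1).
Let beta := set_one alpha m.
Context (E : set (circle_borel R) -> operator R).
Context (HE : spectral_measure J (Uop beta) E).
Context (Jk0 : J k0) (J_pred : forall k, k != m -> J (k - 1) <-> J k).
Context (J_inv : forall f : int -> R[i], (forall k, ~ J k -> f k = 0) ->
  forall k, ~ J k -> Uop beta f k = 0).
Context (mu : {measure set (circle_borel R) -> \bar R}).
Context (muE : forall A, measurable A ->
  diagonal_measure E (delta R k0) A = mu A).
Implicit Types (k : int) (h : circle_borel R -> R[i]) (v : int -> R[i]).
Let V := block_operator evenz beta.
Let ap := approx J E (delta R k0) mu.
Let lf0 := @l2_delta R J k0 Jk0.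
Let zeta (x : circle_borel R) : R[i] := val x.

Lemma evenz_alternating : alternating evenz. Proof. exact: evenzS. Qed.
Lemma oddz_alternating : alternating oddz. Proof. exact: oddzS. Qed.

Let alpha_c k : normc (alpha k) < 1.
Proof. by rewrite -ltcR -[(normc _)%:C]/(`|alpha k|). Qed.

Lemma set_one_le1 k : normc (beta k) <= 1.
Proof.
rewrite /beta /set_one; case: ifP => _; first by rewrite normc1.
exact/ltW/alpha_c.
Qed.

Lemma set_oneE k : k != m -> beta k = alpha k.
Proof. by move=> /negPf km; rewrite /beta /set_one km. Qed.

Lemma rho_set_oneE k : k != m -> rho beta k = rho alpha k.
Proof. by move=> km; rewrite /rho set_oneE. Qed.

Lemma V_lower k : k != m -> evenz k -> V (delta R k) = fun x =>
  (rho alpha k)%:C * delta R (k - 1) x + (alpha k)^* * delta R k x.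
Proof.
move=> km; rewrite -(rho_set_oneE km) -(set_oneE km).
exact: block_delta_lower evenz_alternating.
Qed.

Lemma V_upper k : k != m -> evenz k -> V (delta R (k - 1)) = fun x =>
  - alpha k * delta R (k - 1) x + (rho alpha k)%:C * delta R k x.
Proof.
move=> km; rewrite -(rho_set_oneE km) -(set_oneE km).
exact: block_delta_upper evenz_alternating.
Qed.

Lemma U_lower k : k != m -> oddz k -> Uop beta (delta R k) = fun x =>
  (rho alpha k)%:C * V (delta R (k - 1)) x + (alpha k)^* * V (delta R k) x.
Proof.
move=> km ok; rewrite -(rho_set_oneE km) -(set_oneE km).
rewrite /Uop /= /Vop /Wop (block_delta_lower _ oddz_alternating ok).
exact: block_operator_linear.
Qed.

Lemma U_upper k : k != m -> oddz k -> Uop beta (delta R (k - 1)) = fun x =>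
  - alpha k * V (delta R (k - 1)) x + (rho alpha k)%:C * V (delta R k) x.
Proof.
move=> km ok; rewrite -(rho_set_oneE km) -(set_oneE km).
rewrite /Uop /= /Vop /Wop (block_delta_upper _ oddz_alternating ok).
exact: block_operator_linear.
Qed.

Let beta_m : beta m = 1. Proof. by rewrite /beta /set_one eqxx. Qed.

Let rho_m : rho beta m = 0.
Proof. by rewrite /rho beta_m normc1 expr1n subrr sqrtr0. Qed.

(** The cut block is diag(-1, 1). The four cut lemmas treat both parities of m and both sides of the
    cut; k0 is m on the right half and m - 1 on the left, and the factor 1 or -1 is the c of
    [matched_V] and [matched_U]. *)
Lemma V_cut_lower : evenz m -> V (delta R m) = fun k => 1 * delta R m k.
Proof.
move=> em; rewrite /V; have -> := block_delta_lower beta evenz_alternating em.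
by apply/funext => k; rewrite rho_m beta_m rmorph1 mul0r add0r.
Qed.

Lemma V_cut_upper : evenz m ->
  V (delta R (m - 1)) = fun k => -1 * delta R (m - 1) k.
Proof.
move=> em; rewrite /V; have -> := block_delta_upper beta evenz_alternating em.
by apply/funext => k; rewrite rho_m beta_m mul0r addr0.
Qed.

Lemma U_cut_lower : oddz m ->
  V (delta R m) = fun k => 1 * Uop beta (delta R m) k.
Proof.
move=> om; rewrite /Uop /= /Wop (block_delta_lower beta oddz_alternating om).
apply/funext => k; rewrite /Vop block_operator_linear rho_m beta_m rmorph1.
by rewrite mul0r add0r !mul1r.
Qed.

Lemma U_cut_upper : oddz m ->
  V (delta R (m - 1)) = fun k => -1 * Uop beta (delta R (m - 1)) k.
Proof.
move=> om; rewrite /Uop /= /Wop (block_delta_upper beta oddz_alternating om).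
apply/funext => k; rewrite /Vop block_operator_linear rho_m beta_m.
by rewrite mul0r addr0 !mulN1r opprK.
Qed.

Lemma l2_U_delta k : J k -> l2 J (Uop beta (delta R k)).
Proof.
move=> Jk; split; last by apply: J_inv; case: (l2_delta R Jk).
exact: L2_block_block evenz_alternating oddz_alternating.
Qed.

Lemma approx_zeta k h : J k -> ap h (delta R k) ->
  ap (fun x => zeta x * h x) (Uop beta (delta R k)).
Proof.
move=> Jk H; apply: (approxM HE lf0 muE (b := zeta) _ _ _ H).
- exact: cmeasurable_zeta.
- by move=> x; rewrite normc_circle.
- exact: l2_U_delta.
- by apply: (approx_mul_zeta HE); [exact: l2_delta|exact: l2_U_delta|rewrite nrm_delta].
Qed.

(** Multiplying by conj(zeta), the inverse of zeta on the circle, leads back from U delta_k to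
    delta_k. *)
Lemma approx_zetaV k h : J k ->
  ap (fun x => zeta x * h x) (Uop beta (delta R k)) -> ap h (delta R k).
Proof.
move=> Jk H; have := approxM HE lf0 muE (b := fun x => (zeta x)^*)
  (cmeasurableJ (@cmeasurable_zeta R)) _ (l2_delta R Jk) H _.
rewrite (_ : (fun x => (zeta x)^* * (zeta x * h x)) = h).
  apply; first by move=> x; rewrite normcJ normc_circle.
  by apply: (approx_mul_zetaV HE); [exact: l2_delta|exact: l2_U_delta|rewrite nrm_delta].
by apply/funext => x; rewrite mulrA mulJc normc_circle expr1n mul1r.
Qed.

Section ThetaRelation.
Context (a : R[i]) (c : R) (hx hx' hy hy' : circle_borel R -> R[i]).
Context (vx vx' vy vy' : int -> R[i]).
Context (c0 : c != 0).
Context (hyE : hy = fun x => - a * hx x + c%:C * hx' x).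
Context (hyE' : hy' = fun x => c%:C * hx x + a^* * hx' x).
Context (vyE : vy = fun x => - a * vx x + c%:C * vx' x).
Context (vyE' : vy' = fun x => c%:C * vx x + a^* * vx' x).

Let ap_comb (b d : R[i]) h h' v v' : ap h v -> ap h' v' ->
  ap (fun x => b * h x + d * h' x) (fun x => b * v x + d * v' x).
Proof.
by move=> H H'; apply: (approxD HE lf0 muE); apply: (approxZ HE lf0 muE).
Qed.

Let cU : c%:C != 0 :> R[i]. Proof. by rewrite fmorph_eq0. Qed.

(** One matrix couples the functions and the vectors. Its upper row is solved for the primed entry,
    as c is not 0, and its lower row then gives the other one. *)
Lemma theta_up : ap hx vx -> ap hy vy -> ap hx' vx' /\ ap hy' vy'.
Proof.
move=> H1 H2; have H3 : ap hx' vx'.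
  have := ap_comb c%:C^-1 (c%:C^-1 * a) H2 H1; congr ap; apply/funext => x.
    by rewrite hyE; field.
  by rewrite vyE; field.
by split=> //; rewrite hyE' vyE'; exact: ap_comb.
Qed.

Lemma theta_down : ap hx' vx' -> ap hy' vy' -> ap hx vx /\ ap hy vy.
Proof.
move=> H1 H2; have H3 : ap hx vx.
  have := ap_comb c%:C^-1 (- c%:C^-1 * a^*) H2 H1; congr ap; apply/funext => x.
    by rewrite hyE'; field.
  by rewrite vyE'; field.
by split=> //; rewrite hyE vyE; exact: ap_comb.
Qed.

End ThetaRelation.

Section Recursion.
Context (p r : int -> circle_borel R -> R[i]).
Context (p_even : forall k x, evenz k ->
  p k x = (rho alpha k)%:C^-1 * ((alpha k)^* * p (k - 1) x + r (k - 1) x)).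
Context (r_even : forall k x, evenz k ->
  r k x = (rho alpha k)%:C^-1 * (p (k - 1) x + alpha k * r (k - 1) x)).
Context (p_odd : forall k x, oddz k ->
  p k x = (rho alpha k)%:C^-1 * (alpha k * p (k - 1) x + zeta x * r (k - 1) x)).
Context (r_odd : forall k x, oddz k -> r k x =
  (rho alpha k)%:C^-1 * ((zeta x)^-1 * p (k - 1) x + (alpha k)^* * r (k - 1) x)).
Context (mp0 : cmeasurable (p k0)) (p0 : forall x, normc (p k0 x) = 1).

Let H k x := (p k x)^* * p k0 x.
Let G k x := (r k x)^* * p k0 x.

Let realJ (c : R) : c%:C^* = c%:C :> R[i].
Proof. by apply/eqP; rewrite eq_complex /= oppr0 !eqxx. Qed.

Let zetaJ x : (zeta x)^-1 = (zeta x)^*.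
Proof.
have : (zeta x)^* * zeta x = 1 by rewrite mulJc normc_circle expr1n.
move=> zz; have z0 : zeta x != 0.
  by apply: contra_eqN zz => /eqP ->; rewrite mulr0 eq_sym oner_eq0.
by apply: (mulIf z0); rewrite zz mulVf.
Qed.

Let zetaK x : zeta x * (zeta x)^* = 1.
Proof. by rewrite mulrC mulJc normc_circle expr1n. Qed.

Let rhoU k : (rho alpha k)%:C != 0 :> R[i].
Proof. by rewrite fmorph_eq0 gt_eqF// rho_gt0. Qed.

Let rho2 k : (rho alpha k)%:C * (rho alpha k)%:C + (alpha k)^* * alpha k = 1 :> R[i].
Proof. by apply: rho_sqr => j; exact/ltW/alpha_c. Qed.

Let pJ_even k x : evenz k -> (p k x)^* =
  (rho alpha k)%:C^-1 * (alpha k * (p (k - 1) x)^* + (r (k - 1) x)^*).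
Proof.
by move=> ek; rewrite p_even// rmorphM rmorphD fmorphV rmorphM /= realJ conjCK.
Qed.

Let rJ_even k x : evenz k -> (r k x)^* =
  (rho alpha k)%:C^-1 * ((p (k - 1) x)^* + (alpha k)^* * (r (k - 1) x)^*).
Proof.
by move=> ek; rewrite r_even// rmorphM rmorphD fmorphV rmorphM /= realJ.
Qed.

Let rJ_odd k x : oddz k -> (r k x)^* =
  (rho alpha k)%:C^-1 * (alpha k * (r (k - 1) x)^* + zeta x * (p (k - 1) x)^*).
Proof.
move=> ok; rewrite r_odd// rmorphM rmorphD fmorphV !rmorphM /= realJ zetaJ.
by rewrite !conjCK addrC.
Qed.

Let pJ_odd k x : oddz k -> zeta x * (p k x)^* = (rho alpha k)%:C^-1 *
  ((r (k - 1) x)^* + (alpha k)^* * (zeta x * (p (k - 1) x)^*)).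
Proof.
move=> ok; rewrite p_odd// rmorphM rmorphD fmorphV !rmorphM /= realJ mulrCA.
congr (_ * _).
rewrite mulrDr [zeta x * ((zeta x)^* * _)]mulrA zetaK mul1r addrC.
by rewrite [zeta x * (_ * _)]mulrCA.
Qed.

Lemma GE_even k : evenz k ->
  G (k - 1) = fun x => - alpha k * H (k - 1) x + (rho alpha k)%:C * H k x.
Proof.
move=> ek; apply/funext => x.
exact: (theta_upper (p k0 x) (rhoU k) (pJ_even x ek)).
Qed.

Lemma GE_even' k : evenz k ->
  G k = fun x => (rho alpha k)%:C * H (k - 1) x + (alpha k)^* * H k x.
Proof.
move=> ek; apply/funext => x.
exact: (theta_lower (p k0 x) (rhoU k) (rho2 k) (pJ_even x ek) (rJ_even x ek)).
Qed.

Lemma GE_odd k : oddz k -> (fun x => zeta x * H (k - 1) x) =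
  fun x => - alpha k * G (k - 1) x + (rho alpha k)%:C * G k x.
Proof.
move=> ok; apply/funext => x; rewrite mulrA.
exact: (theta_upper (p k0 x) (rhoU k) (rJ_odd x ok)).
Qed.

Lemma GE_odd' k : oddz k -> (fun x => zeta x * H k x) =
  fun x => (rho alpha k)%:C * G (k - 1) x + (alpha k)^* * G k x.
Proof.
move=> ok; apply/funext => x; rewrite mulrA.
exact: (theta_lower (p k0 x) (rhoU k) (rho2 k) (rJ_odd x ok) (pJ_odd x ok)).
Qed.

Definition matched k := ap (H k) (delta R k) /\ ap (G k) (V (delta R k)).

(** Start of the induction when the cut block belongs to V: H_k0 = 1 matches delta_k0, and G_k0 must
    be the constant c. *)
Lemma matched_V (c : R[i]) : V (delta R k0) = (fun k => c * delta R k0 k) ->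
  (forall x, (r k0 x)^* * p k0 x = c) -> matched k0.
Proof.
move=> Vc rp; have H1 : H k0 = fun _ => 1.
  by apply/funext => x; rewrite /H mulJc p0 expr1n.
have A1 := approx1 HE lf0 muE; rewrite /matched H1 Vc; split=> //.
have := approxZ HE lf0 muE c A1; congr approx; apply/funext => x.
by rewrite mulr1 /G rp.
Qed.

(** Start of the induction when the cut block belongs to W: G_k0 must be c zeta, the counterpart of
    c U delta_k0. *)
Lemma matched_U (c : R[i]) :
  V (delta R k0) = (fun k => c * Uop beta (delta R k0) k) ->
  (forall x, (r k0 x)^* * p k0 x = c * zeta x) -> matched k0.
Proof.
move=> Vc rp; have H1 : H k0 = fun _ => 1.
  by apply/funext => x; rewrite /H mulJc p0 expr1n.
have A1 := approx1 HE lf0 muE; rewrite /matched H1 Vc; split=> //.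
have := approxZ HE lf0 muE c (approx_zeta Jk0 A1); congr approx; apply/funext => x.
by rewrite mulr1 /G rp.
Qed.

Lemma matched_up k : k != m -> J k -> matched (k - 1) -> matched k.
Proof.
move=> km Jk [h1 h2]; have r0 := rhoU k; rewrite fmorph_eq0 in r0.
have Jk1 : J (k - 1) by exact/(J_pred km).
have [ek|ok] := boolP (evenz k).
  exact: (theta_up r0 (GE_even ek) (GE_even' ek) (V_upper km ek) (V_lower km ek)).
(* For odd k the roles are exchanged: theta_k acts on the pair G_(k-1), G_k and yields zeta H_(k-1),
   zeta H_k, so zeta is put in before the step and removed after it. *)
have [A1 A2] := theta_up r0 (GE_odd ok) (GE_odd' ok) (U_upper km ok) (U_lower km ok)
  h2 (approx_zeta Jk1 h1).
by split=> //; exact: approx_zetaV A2.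
Qed.

Lemma matched_down k : k != m -> J k -> matched k -> matched (k - 1).
Proof.
move=> km Jk [h1 h2]; have r0 := rhoU k; rewrite fmorph_eq0 in r0.
have Jk1 : J (k - 1) by exact/(J_pred km).
have [ek|ok] := boolP (evenz k).
  exact: (theta_down r0 (GE_even ek) (GE_even' ek) (V_upper km ek) (V_lower km ek)).
have [A1 A2] := theta_down r0 (GE_odd ok) (GE_odd' ok) (U_upper km ok) (U_lower km ok)
  h2 (approx_zeta Jk h1).
by split=> //; exact: approx_zetaV A2.
Qed.

(** The other site of the block containing k lies in J unless the block is cut, and then its
    coefficient rho_m is 0. *)
Lemma delta_finite_span_V k : J k ->
  finite_span J (fun j => V (delta R j)) (delta R k).
Proof.
move=> Jk; have [ek|ok] := boolP (evenz k).
  rewrite (delta_lowerE set_one_le1 evenz_alternating ek).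
  have [km|km] := eqVneq k m.
    rewrite [X in finite_span _ _ X](_ : _ = fun x => beta k * V (delta R k) x).
      exact: finite_span1.
    by apply/funext => x; rewrite {1}km rho_m mul0r add0r.
  by apply: finite_spanD; apply: finite_span1 => //; exact/(J_pred km).
have ek : evenz (k + 1) by rewrite evenzS.
rewrite -{1}[k](addrK 1) (delta_upperE set_one_le1 evenz_alternating ek) addrK.
have [km|km] := eqVneq (k + 1) m.
  rewrite [X in finite_span _ _ X](_ : _ =
    fun x => - (beta (k + 1))^* * V (delta R k) x); first exact: finite_span1.
  by apply/funext => x; rewrite {2}km rho_m mul0r addr0.
apply: finite_spanD; apply: finite_span1 => //.
by apply/(J_pred km); rewrite addrK.
Qed.

Lemma matched_basis : (forall k, J k -> matched k) ->
  orthonormal_basis (diagonal_measure E (delta R k0)) J p /\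
  orthonormal_basis (diagonal_measure E (delta R k0)) J r.
Proof.
move=> Hm.
split.
  apply: (approx_orthonormal_basis HE lf0 muE (w := fun j => delta R j) mp0 p0).
  - by move=> k /Hm [].
  - by move=> j k _ _; rewrite /l2ip ip_deltal /delta eq_sym.
  - move=> v lv e e0; have [s [Js sv]] := l2_dense lv e0.
    exists (fun x => \sum_(k <- s) v k * delta R k x) => //.
    by apply: finite_span_sum => k /Js; exact: finite_span1.
apply: (approx_orthonormal_basis HE lf0 muE (w := fun j => V (delta R j)) mp0 p0).
- by move=> k /Hm [].
- by move=> j k _ _; exact: (block_delta_orthonormal set_one_le1 _ _ evenz_alternating).
- move=> v lv e e0; have [s [Js sv]] := l2_dense lv e0.
  exists (fun x => \sum_(k <- s) v k * delta R k x) => //.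
  apply: finite_span_sum => k /Js Jk; apply: finite_spanZ.
  exact: delta_finite_span_V.
Qed.

End Recursion.

End HalfLattice.

(** * The transfer recursion in components *)

Section TransferRecursion.
Context (R : realType) (alpha : int -> R[i]).
Context (alpha_lt1 : forall k, `|alpha k| < 1).
Context (z : R[i]) (z0 : z != 0) (k0 : int) (w : 'cV[R[i]]_2).
Let p k := transfer_solution alpha z k0 w k 0 0.
Let r k := transfer_solution alpha z k0 w k 1 0.

Let sum2 (F : 'I_2 -> R[i]) : \sum_(i < 2) F i = F 0 + F 1.
Proof.
rewrite !big_ord_recl big_ord0 addr0; congr (_ + F _); exact/val_inj.
Qed.

Let rhoV k : ((rho alpha k)^-1)%:C = (rho alpha k)%:C^-1 :> R[i].
Proof. exact: fmorphV. Qed.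

Lemma transfer_even k : evenz k ->
  p k = (rho alpha k)%:C^-1 * ((alpha k)^* * p (k - 1) + r (k - 1)) /\
  r k = (rho alpha k)%:C^-1 * (p (k - 1) + alpha k * r (k - 1)).
Proof.
move=> ek; rewrite /p /r (transfer_solution_rec _ _ k alpha_lt1 z0).
rewrite ![(_ *m _) _ _]mxE !sum2 /transfer /oddz ek /= !mxE /= rhoV.
by split; ring.
Qed.

Lemma transfer_odd k : oddz k ->
  p k = (rho alpha k)%:C^-1 * (alpha k * p (k - 1) + z * r (k - 1)) /\
  r k = (rho alpha k)%:C^-1 * (z^-1 * p (k - 1) + (alpha k)^* * r (k - 1)).
Proof.
move=> ok; rewrite /p /r (transfer_solution_rec _ _ k alpha_lt1 z0).
rewrite ![(_ *m _) _ _]mxE !sum2 /transfer ok !mxE /= rhoV.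
by split; rewrite -!mulrA -mulrDr.
Qed.

End TransferRecursion.

Lemma circle_neq0 (R : realType) (x : circle_borel R) : val x != 0.
Proof.
by apply: contra_eqN (normc_circle x) => /eqP ->; rewrite normc0 eq_sym oner_eq0.
Qed.

(** * The two half-lattices *)

Section Half.
Context (R : realType) (alpha : int -> R[i]) (k0 : int).
Context (alpha_lt1 : forall k, `|alpha k| < 1).
Implicit Type E : set (circle_borel R) -> operator R.
Let zeta (x : circle_borel R) : R[i] := val x.

Let transfer_evenP (w : R[i] -> 'cV[R[i]]_2) k (x : circle_borel R) (ek : evenz k) :=
  transfer_even alpha_lt1 (circle_neq0 x) k0 (w (zeta x)) ek.
Let transfer_oddP (w : R[i] -> 'cV[R[i]]_2) k (x : circle_borel R) (ok : oddz k) :=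
  transfer_odd alpha_lt1 (circle_neq0 x) k0 (w (zeta x)) ok.

Lemma plus_basis E :
  spectral_measure (half_plus k0) (U_plus alpha k0) E ->
  let mu := diagonal_measure E (delta R k0) in
  orthonormal_basis mu (half_plus k0)
    (fun k zeta => p_plus alpha (val zeta) k k0) /\
  orthonormal_basis mu (half_plus k0)
    (fun k zeta => r_plus alpha (val zeta) k k0).
Proof.
move=> HE; have Jk0 : half_plus k0 k0 by rewrite /half_plus /=.
have J_pred k : k != k0 -> half_plus k0 (k - 1) <-> half_plus k0 k.
  by move=> kk0; rewrite /half_plus /= lerBrDr lezD1 lt_neqAle eq_sym kk0.
have [mu muE] := spectral_scalar HE (l2_delta R Jk0).
have p0E x : p_plus alpha (zeta x) k0 k0 = init_plus (zeta x) k0 0 0.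
  by rewrite /p_plus transfer_solution_init.
have r0E x : r_plus alpha (zeta x) k0 k0 = init_plus (zeta x) k0 1 0.
  by rewrite /r_plus transfer_solution_init.
have mp0 : cmeasurable (fun x => p_plus alpha (zeta x) k0 k0).
  under eq_fun do rewrite p0E /init_plus.
  case: (oddz k0); under eq_fun do rewrite mxE /=.
    exact: cmeasurable_zeta.
  exact: cmeasurable_cst.
have p0 x : normc (p_plus alpha (zeta x) k0 k0) = 1.
  by rewrite p0E /init_plus; case: (oddz k0); rewrite mxE ?normc1 ?normc_circle.
have J_inv f := @U_plus_half R alpha k0 f.
pose w z := init_plus z k0 : 'cV[R[i]]_2.
have pe k (x : circle_borel R) (ek : evenz k) := proj1 (transfer_evenP w x ek).
have re k (x : circle_borel R) (ek : evenz k) := proj2 (transfer_evenP w x ek).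
have po k (x : circle_borel R) (ok : oddz k) := proj1 (transfer_oddP w x ok).
have ro k (x : circle_borel R) (ok : oddz k) := proj2 (transfer_oddP w x ok).
apply: (matched_basis alpha_lt1 HE Jk0 J_pred muE mp0 p0) => k kk0.
have -> : k = k0 + `|k - k0|%:Z.
  by rewrite gez0_abs ?subr_ge0// addrCA subrr addr0.
elim: `|k - k0|%N => {k kk0} [|n IH].
  (* The initial values (1, 1) give G_k0 = 1 for k0 even, and (z, 1) give G_k0 = zeta for k0 odd. *)
  rewrite addr0; have [ek|ok] := boolP (evenz k0).
    apply: (matched_V HE Jk0 muE p0 (V_cut_lower alpha ek)) => // x.
    by rewrite p0E r0E /init_plus /oddz ek !mxE rmorph1 mul1r.
  apply: (matched_U HE Jk0 J_inv muE p0 (U_cut_lower alpha ok)) => // x.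
  by rewrite p0E r0E /init_plus /oddz ok !mxE rmorph1.
(* The step up to k0 + n + 1 uses the block at that site, which is never the cut block at k0. *)
have nk0 : k0 + n.+1%:Z != k0 by rewrite -subr_eq0 addrAC subrr add0r.
apply: (matched_up alpha_lt1 HE Jk0 J_pred J_inv muE pe re po ro nk0).
- by rewrite /half_plus /= lerDl.
- have -> : k0 + n.+1%:Z - 1 = k0 + n%:Z by rewrite -addn1 PoszD addrA addrK.
  exact: IH.
Qed.

Lemma minus_basis E :
  spectral_measure (half_minus k0) (U_minus alpha k0) E ->
  let mu := diagonal_measure E (delta R k0) in
  orthonormal_basis mu (half_minus k0)
    (fun k zeta => p_minus alpha (val zeta) k k0) /\
  orthonormal_basis mu (half_minus k0)
    (fun k zeta => r_minus alpha (val zeta) k k0).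
Proof.
move=> HE; have Jk0 : half_minus k0 k0 by rewrite /half_minus /=.
have J_pred k : k != k0 + 1 -> half_minus k0 (k - 1) <-> half_minus k0 k.
  by move=> kk0; rewrite /half_minus /= lerBlDr -ltzD1 lt_neqAle kk0.
have [mu muE] := spectral_scalar HE (l2_delta R Jk0).
have p0E x : p_minus alpha (zeta x) k0 k0 = init_minus (zeta x) k0 0 0.
  by rewrite /p_minus transfer_solution_init.
have r0E x : r_minus alpha (zeta x) k0 k0 = init_minus (zeta x) k0 1 0.
  by rewrite /r_minus transfer_solution_init.
have mp0 : cmeasurable (fun x => p_minus alpha (zeta x) k0 k0).
  under eq_fun do rewrite p0E /init_minus.
  case: (oddz k0); under eq_fun do rewrite mxE /=; first exact: cmeasurable_cst.
  under eq_fun do rewrite -mulN1r.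
  by apply: cmeasurableZ; exact: cmeasurable_zeta.
have p0 x : normc (p_minus alpha (zeta x) k0 k0) = 1.
  rewrite p0E /init_minus; case: (oddz k0); rewrite mxE ?normc1//.
  by rewrite normcN normc_circle.
have J_inv f := @U_minus_half R alpha k0 f.
pose w z := init_minus z k0 : 'cV[R[i]]_2.
have pe k (x : circle_borel R) (ek : evenz k) := proj1 (transfer_evenP w x ek).
have re k (x : circle_borel R) (ek : evenz k) := proj2 (transfer_evenP w x ek).
have po k (x : circle_borel R) (ok : oddz k) := proj1 (transfer_oddP w x ok).
have ro k (x : circle_borel R) (ok : oddz k) := proj2 (transfer_oddP w x ok).
apply: (matched_basis alpha_lt1 HE Jk0 J_pred muE mp0 p0) => k kk0.
have -> : k = k0 - `|k0 - k|%:Z.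
  by rewrite gez0_abs ?subr_ge0// opprB addrCA subrr addr0.
elim: `|k0 - k|%N => {k kk0} [|n IH].
  (* The cut site k0 + 1 has the parity opposite to k0. For k0 even, (-z, 1) gives G_k0 = - zeta;
     for k0 odd, (1, -1) gives G_k0 = -1. *)
  rewrite subr0; have [ek|ok] := boolP (evenz k0).
    have om : oddz (k0 + 1) by rewrite oddzS /oddz ek.
    have := U_cut_upper alpha om; rewrite addrK => Vc.
    apply: (matched_U HE Jk0 J_inv muE p0 Vc) => // x.
    by rewrite p0E r0E /init_minus /oddz ek !mxE rmorph1 mul1r mulN1r.
  have em : evenz (k0 + 1) by rewrite evenzS.
  have := V_cut_upper alpha em; rewrite addrK => Vc.
  apply: (matched_V HE Jk0 muE p0 Vc) => // x.
  by rewrite p0E r0E /init_minus /oddz ok !mxE /= rmorphN rmorph1 mulr1.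
(* The step down from k0 - n uses the block at k0 - n itself, so the cut block at k0 + 1 is avoided
   already for n = 0. *)
have nk0 : k0 - n%:Z != k0 + 1.
  by rewrite lt_eqF// (@le_lt_trans _ _ k0)// ?ltrDl// lerBlDr lerDl.
have -> : k0 - n.+1%:Z = k0 - n%:Z - 1 by rewrite -addn1 PoszD opprD addrA.
apply: (matched_down alpha_lt1 HE Jk0 J_pred J_inv muE pe re po ro nk0 _ IH).
by rewrite /half_minus /= lerBlDr lerDl.
Qed.

End Half.

Theorem lemma2p8 (R : realType) (alpha : int -> R[i])
    (E_plus E_minus : set (circle_borel R) -> operator R) (k0 : int) :
  (forall k, `|alpha k| < 1) ->
  spectral_measure (half_plus k0) (U_plus alpha k0) E_plus ->
  spectral_measure (half_minus k0) (U_minus alpha k0) E_minus ->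
  let mu_plus := diagonal_measure E_plus (delta R k0) in
  let mu_minus := diagonal_measure E_minus (delta R k0) in
  [/\ orthonormal_basis mu_plus (half_plus k0)
        (fun k zeta => p_plus alpha (val zeta) k k0),
      orthonormal_basis mu_plus (half_plus k0)
        (fun k zeta => r_plus alpha (val zeta) k k0),
      orthonormal_basis mu_minus (half_minus k0)
        (fun k zeta => p_minus alpha (val zeta) k k0) &
      orthonormal_basis mu_minus (half_minus k0)
        (fun k zeta => r_minus alpha (val zeta) k k0)].
Proof.
move=> alpha_lt1 HP HM mu_plus mu_minus.
have [pP rP] := plus_basis alpha_lt1 HP; have [pM rM] := minus_basis alpha_lt1 HM.
split; [exact: pP|exact: rP|exact: pM|exact: rM].
Qed.
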